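(* Let $\zeta_Z(t),t\in\mathcal T$ be the max-stable process associated to a measurable spectral process $Z(t),t\in\mathcal T$ with values in $[-\infty,\infty)$ and $\mathbb E\{e^{Z(t)}\}=1$, $t\in\mathcal T$. Let $\mu$ be a positive $\sigma$-finite measure on $\mathcal T$ such that $\mathcal M_Z=\sup_{t\in\mathcal T}e^{Z(t)}$ and $\mathcal S_Z=\int_{\mathcal T}e^{Z(t)}\mu(dt)$ are two non-negative finite random variables and $$\mathbb P\{\mathcal M_Z>0,\ \mathcal S_Z=0\}=0.$$ Then $$\zeta_Z(t)\overset{fdd}{=}\max_{i\ge1}\bigl(P_i+F_i(t,T_i)\bigr),\qquad t\in\mathcal T,$$ where $(P_i,T_i)$ are the points of a Poisson point process on $\mathbb R\times\mathcal T$ with intensity $e^{-p}dp\cdot\mu(dt)$, independent of the $F_i$'s, which are independent copies of the random shape function $$F(t,h)=\Theta_h(t)-\ln\int_{\mathcal T}e^{\Theta_h(s)}\mu(ds),\qquad h,t\in\mathcal T.$$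
   Context: $\mathcal T=\mathbb R^d$ or $\mathbb Z^d$, $d\ge1$; $e^{-\infty}=0$; $\overset{fdd}{=}$ means equality of all finite dimensional distributions. The associated max-stable process is $\zeta_Z(t)=\max_{i\ge1}(P_i+Z_i(t))$, $t\in\mathcal T$, where $\sum_i\varepsilon_{P_i}$ is a Poisson point process on $\mathbb R$ with intensity $e^{-x}dx$ and $Z_i$ are independent copies of $Z$, independent of the point process. For $h\in\mathcal T$ (note $\mathbb P\{Z(h)>-\infty\}>0$), let $V_h$ have the conditional law of $Z$ given $Z(h)>-\infty$, let $V_h^{[h]}$ have law $\mathbb P\{V_h^{[h]}\in A\}=\mathbb E\{e^{V_h(h)-\ln\mathbb E\{e^{V_h(h)}\}}\mathbb I\{V_h\in A\}\}$ for $A$ in the $\sigma$-field generated by the evaluation maps, and set $\Theta_h(t)=V_h^{[h]}(t)-V_h^{[h]}(h)$, $t\in\mathcal T$. $F_i(\cdot,T_i)$ is understood as follows: conditionally on the points $(P_i,T_i)_{i\ge1}$, the processes $F_i(\cdot,T_i)$ are independent, the $i$-th one having the law of $F(\cdot,h)$ with $h=T_i$. *)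

(* Defs.v *)
From HB Require Import structures.
From mathcomp Require Import all_boot all_order all_algebra.
From mathcomp Require Import all_classical all_reals all_analysis.
From mathcomp Require Import measurable_realfun.

Set Implicit Arguments.
Unset Strict Implicit.
Unset Printing Implicit Defensive.

Import Order.TTheory GRing.Theory Num.Theory.
Import numFieldNormedType.Exports.

Local Open Scope classical_set_scope.
Local Open Scope ring_scope.

(* [int] carries the discrete sigma-algebra, so that the product sigma-algebra
   of [d.-tuple int] is again the discrete one; that of [d.-tuple R] is the
   Borel sigma-algebra of R^d. *)
HB.instance Definition _ := isPointed.Build int 0.

HB.instance Definition _ := @isMeasurable.Build default_measure_display
  int discrete_measurable discrete_measurable0
  discrete_measurableC discrete_measurableU.

Inductive index_kind := Continuous | Lattice.

Definition index_space (R : realType) (k : index_kind) (d : nat) :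
    measurableType (measure_tuple_display default_measure_display) :=
  match k with
  | Continuous => (d.-tuple R)%type
  | Lattice => (d.-tuple int)%type
  end.

Section sigma_fields.
Context (aT : Type) (J : Type) (d : measure_display) (rT : measurableType d).

Definition sigma_of (X : J -> aT -> rT) : set (set aT) :=
  <<s [set A | exists j B, measurable B /\ A = X j @^-1` B] >>.

End sigma_fields.

Section paths.
Context (R : realType) (T : Type).

Definition path_sigma : set (set (T -> \bar R)) :=
  sigma_of (fun (t : T) (f : T -> \bar R) => f t).

Definition path_of (W : Type) (Y : T -> W -> \bar R) (w : W) : T -> \bar R :=
  fun t => Y t w.

End paths.

Section independence.
Context (R : realType) (d : measure_display) (W : measurableType d).
Local Open Scope ereal_scope.

Definition mutually_independent (P : probability W R) (J : eqType)
    (F : J -> set (set W)) : Prop :=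
  forall (s : seq J) (A : J -> set W), uniq s ->
    (forall j, j \in s -> F j (A j)) ->
    P (\bigcap_(j in [set` s]) A j) = \prod_(j <- s) P (A j).

End independence.

Section poisson_point_process.
Context (R : realType) (dW : measure_display) (W : measurableType dW).
Context (dE : measure_display) (E : measurableType dE).
Local Open Scope ereal_scope.

Definition point_count (X : nat -> W -> E) (A : set E) (w : W) : \bar R :=
  \sum_(0 <= i <oo) \d_(X i w) A.

(* The points are given through an enumeration by random elements, hence
   there are infinitely many of them: the intensities considered here have
   infinite total mass.  The second argument of [poisson_prob] is a dummy. *)
Definition poisson_process (P : probability W R) (X : nat -> W -> E)
    (Lambda : set E -> \bar R) : Prop :=
  [/\ forall i, measurable_fun setT (X i),
      forall A, measurable A -> Lambda A < +oo -> forall k : nat,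
        P [set w | point_count X A w = k%:R%:E] =
        poisson_prob (fine (Lambda A)) k [set k],
      forall A, measurable A -> Lambda A = +oo ->
        P [set w | point_count X A w = +oo] = 1 &
      forall (n : nat) (A : 'I_n -> set E),
        (forall i, measurable (A i)) -> trivIset setT A ->
        mutually_independent P
          (fun i => preimage_set_system setT (point_count X (A i)) measurable)].

End poisson_point_process.

Section max_stable.
Context (R : realType) (dT : measure_display) (T : measurableType dT).
Local Open Scope ereal_scope.

Definition max_process (W : Type) (X : nat -> W -> R)
    (Y : nat -> T -> W -> \bar R) (t : T) (w : W) : \bar R :=
  ereal_sup (range (fun i => (X i w)%:E + Y i t w)).

Definition fdd_eq (d1 d2 : measure_display)
    (W1 : measurableType d1) (P1 : probability W1 R) (Y1 : T -> W1 -> \bar R)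
    (W2 : measurableType d2) (P2 : probability W2 R) (Y2 : T -> W2 -> \bar R) :
    Prop :=
  forall (n : nat) (t : 'I_n -> T) (B : set (n.-tuple (\bar R))),
    measurable B ->
    P1 [set w | B [tuple Y1 (t i) w | i < n]] =
    P2 [set w | B [tuple Y2 (t i) w | i < n]].

Definition gumbel_intensity (A : set R) : \bar R :=
  \int[lebesgue_measure]_(p in A) (expR (- p))%:E.

Definition gumbel_prod_intensity (mu : {sigma_finite_measure set T -> \bar R})
    (A : set (R * T)) : \bar R :=
  \int[lebesgue_measure \x mu]_(x in A) (expR (- x.1))%:E.

Context (dW : measure_display) (W : measurableType dW) (P : probability W R).
Variable Z : {mfun (T * W)%type >-> \bar R}.

Let Zp (t : T) (w : W) : \bar R := Z (t, w).

(* Independence is from the enumerated sequence [X] of the points, not merely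
   from the random set of points: only then are the [Zs i] marks of the [X i]. *)
Definition spectral_representation (dV : measure_display)
    (V : measurableType dV) (Q : probability V R)
    (X : nat -> V -> R) (Zs : nat -> T -> V -> \bar R) : Prop :=
  [/\ poisson_process Q X gumbel_intensity,
      forall i t, measurable_fun setT (Zs i t),
      forall i A, path_sigma A ->
        Q (path_of (Zs i) @^-1` A) = P (path_of Zp @^-1` A) &
      mutually_independent Q (fun o : option nat =>
        if o is Some i then sigma_of (Zs i) else sigma_of X)].

Definition exceed_bot (h : T) : set W := [set w | -oo < Z (h, w)].

Lemma measurable_exceed_bot h : measurable (exceed_bot h).
Proof.
have mZ : measurable_fun setT (fun w => Z (h, w)).
  exact: measurableT_comp.
rewrite /exceed_bot -[X in measurable X]setTI.
exact: emeasurable_fun_o_infty.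
Qed.

(* V_h is realized as the process Z under the probability [cond_prob h]. *)
Definition cond_prob (h : T) : probability W R :=
  mnormalize (mrestr P (measurable_exceed_bot h)) P.

(* V_h^[h] is realized as the process Z under [tilted h]. *)
Definition tilted (h : T) (A : set W) : \bar R :=
  \int[cond_prob h]_(w in A)
    expeR (Z (h, w) - lne (\int[cond_prob h]_v expeR (Z (h, v)))).

(* Processes on W, to be considered under [tilted h].  Realizing them on W,
   where Z is jointly measurable, gives a meaning to the law of the integral
   in [shape], which is not a functional measurable for [path_sigma]. *)
Definition Theta (h t : T) (w : W) : \bar R := Z (t, w) - Z (h, w).

Variable mu : {sigma_finite_measure set T -> \bar R}.

Definition shape (t h : T) (w : W) : \bar R :=
  Theta h t w - lne (\int[mu]_s expeR (Theta h s w)).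

Definition shape_law (h : T) (A : set (T -> \bar R)) : \bar R :=
  tilted h (path_of (shape ^~ h) @^-1` A).

(* [Fs i t] stands for F_i(t, T_i). *)
Definition shape_representation (dV : measure_display)
    (V : measurableType dV) (Q : probability V R)
    (X : nat -> V -> R) (S : nat -> V -> T) (Fs : nat -> T -> V -> \bar R) :
    Prop :=
  [/\ poisson_process Q (fun i v => (X i v, S i v)) (gumbel_prod_intensity mu),
      forall i t, measurable_fun setT (Fs i t) &
      forall (n : nat) (A : 'I_n -> set (T -> \bar R)) (G : set V),
        (forall i, path_sigma (A i)) ->
        sigma_of (fun i v => (X i v, S i v)) G ->
        Q (G `&` \bigcap_(i in [set: 'I_n]) (path_of (Fs i) @^-1` A i)) =
        \int[Q]_(v in G) \prod_(i < n) shape_law (S i v) (A i)].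

Definition sup_exp (w : W) : \bar R := ereal_sup (range (fun t => expeR (Z (t, w)))).

Definition int_exp (w : W) : \bar R := \int[mu]_t expeR (Z (t, w)).

End max_stable.

(* Main.v *)
Require Import Defs.
From HB Require Import structures.
From mathcomp Require Import all_boot all_order all_algebra.
From mathcomp Require Import all_classical all_reals all_analysis.
From mathcomp Require Import measurable_realfun.

Set Implicit Arguments.
Unset Strict Implicit.
Unset Printing Implicit Defensive.

Import Order.TTheory GRing.Theory Num.Theory.
Import numFieldNormedType.Exports.

Local Open Scope classical_set_scope.
Local Open Scope ring_scope.
Local Open Scope ereal_scope.

(** Both sides have the same finite dimensional distribution functions, and
these determine the laws ([cdf_fdd_eq]).  Fix times [t j] and levels [x j], and
say that a path [f] raised by [p] stays below the levels when
[p + f (t j) <= x j] for all [j].  The maximum of the raised paths is below the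
levels exactly when each of them is.

Given the Poisson points [X i], the marks are independent, so the probability
that all raised marks stay below the levels is the expectation of the product
over [i] of [g (X i)], where [g e] is the probability that a mark attached to
the point [e] stays below.  The Laplace functional of the Poisson process
([laplace_functional]) turns this expectation into [exp (- L)], where [L] is
the integral of [1 - g] against the intensity ([marked_poisson_void]).  It
remains to see that the exponents [L] of the two models agree.

For the spectral model, Tonelli gives [L = E (J Z)], where [J f], called
[excess_mass], is the mass that [exp (- p) dp] gives to the [p] for which the
raised [f] leaves the levels ([spectral_exponent]).  In the shape model the law
attached to [h] has density [exp (Z h)] with respect to [P]
([tilted_density]), and wherever [Z h] is finite the shape function is
[Z - ln S], with [S] the integral of [exp Z] against [mu]: it no longer depends
on [h] ([shape_int_exp]).  Lowering a path by [ln S] divides its excess mass by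
[S] ([excess_mass_shift]), because [exp (- p) dp] is multiplied by
[exp (- s)] under a translation by [s].  Hence, by Tonelli again, the exponent
is the expectation of the integral over [h] of [exp (Z h) * J Z / S], and the
integral over [h] of [exp (Z h)] is [S], which cancels.  Since [S] is almost
surely finite, only the event [S = 0] escapes this cancellation; on it [Z] is
almost surely identically [-oo], by the assumption relating the supremum to
[S], and [J Z = 0]
([integral_shape_excess_mass], [shape_exponent]). *)

(** * Distribution functions determine finite dimensional laws *)

Section fdd.
Context {R : realType}.

Lemma g_sigma_tuple_rays (n : nat) :
  @measurable _ (n.-tuple (\bar R)) `<=`
  <<s [set B | exists x : 'I_n -> \bar R,
        B = [set y : n.-tuple (\bar R) | forall j, tnth y j <= x j]] >>.
Proof.
set G := [set B | _].
apply: smallest_sub; first exact: smallest_sigma_algebra.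
move=> B; rewrite -bigcup_seq => -[j _ [A mA <-]]; rewrite setTI.
have sG := @smallest_sigma_algebra _ setT G.
have := mA; rewrite /measurable /= ErealGenInftyO.measurableE => sA.
apply: (sA [set A | <<s G >> ((fun y : n.-tuple (\bar R) => tnth y j) @^-1` A)]).
split => [|].
  split => [|D mD|F mF] /=.
  - exact: sigma_algebra0.
  - by rewrite setTD; exact: sigma_algebraC.
  - by rewrite preimage_bigcup; exact: sigma_algebra_bigcup.
move=> _ [r ->] /=.
(* An open half-line is a countable union of closed ones; the other
   coordinates are left free by the level [+oo]. *)
have -> : (fun y : n.-tuple (\bar R) => tnth y j) @^-1` `]-oo, r%:E[ =
   \bigcup_m [set y : n.-tuple (\bar R) | forall i,
      tnth y i <= if i == j then (r - m.+1%:R^-1)%:E else +oo].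
  apply/seteqP; split => y /=.
    rewrite in_itv/= => yr.
    have [m ym] : exists m, tnth y j <= (r - m.+1%:R^-1)%:E.
      case: (tnth y j) yr => [s|//|_]; last by exists 0%N; rewrite leNye.
      rewrite lte_fin -subr_gt0 => sr.
      have [m /=] := ltr_add_invr sr.
      rewrite add0r => hm; exists m.
      by rewrite lee_fin lerBrDr -lerBrDl ltW.
    by exists m => // i; case: eqP => [->//|_]; rewrite leey.
  move=> [m _ /(_ j)]; rewrite eqxx => ym.
  rewrite in_itv/= (le_lt_trans ym)// lte_fin ltrBlDr ltrDl.
  by rewrite invr_gt0.
apply: sigma_algebra_bigcup => m.
by apply: sub_sigma_algebra; eexists; reflexivity.
Qed.

(** The sets where all coordinates lie below given levels form a pi-system that
generates the product sigma-algebra.  Levels are extended reals, so that the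
whole space belongs to this pi-system even though the coordinates may take the
value [+oo]. *)
Lemma cdf_fdd_eq (dT : measure_display) (T : measurableType dT)
    (d1 d2 : measure_display)
    (W1 : measurableType d1) (P1 : probability W1 R) (Y1 : T -> W1 -> \bar R)
    (W2 : measurableType d2) (P2 : probability W2 R) (Y2 : T -> W2 -> \bar R) :
  (forall t, measurable_fun setT (Y1 t)) ->
  (forall t, measurable_fun setT (Y2 t)) ->
  (forall n (t : 'I_n -> T) (x : 'I_n -> \bar R),
    P1 [set w | forall j, Y1 (t j) w <= x j] =
    P2 [set w | forall j, Y2 (t j) w <= x j]) ->
  fdd_eq P1 Y1 P2 Y2.
Proof.
move=> mY1 mY2 cdf n t B mB.
have mtup d' (W' : measurableType d') (Y : T -> W' -> \bar R) :
    (forall t, measurable_fun setT (Y t)) ->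
    measurable_fun setT (fun w => [tuple Y (t i) w | i < n]).
  move=> mY; apply/measurable_fun_tnthP => i.
  by apply: (eq_measurable_fun (Y (t i))) => // w _; rewrite /= tnth_mktuple.
have m1 := mtup _ _ _ mY1; have m2 := mtup _ _ _ mY2.
set G := [set B | exists x : 'I_n -> \bar R,
        B = [set y : n.-tuple (\bar R) | forall j, tnth y j <= x j]].
pose Q1 := distribution P1 (mfun_Sub (mem_set m1)).
pose Q2 := distribution P2 (mfun_Sub (mem_set m2)).
have mG : G `<=` measurable.
  move=> _ [x ->].
  have -> : [set y : n.-tuple (\bar R) | forall j, tnth y j <= x j] =
      \bigcap_(j in [set: 'I_n]) ((fun y => tnth y j) @^-1` [set z | z <= x j]).
    by apply/seteqP; split => y /= h j; [move=> _; exact: h|exact: h].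
  apply: fin_bigcap_measurable => // j _; rewrite -[X in measurable X]setTI.
  apply: measurable_tnth => //.
  by rewrite -[X in measurable X]setTI; exact: emeasurable_fun_infty_c.
suff : Q1 B = Q2 B by [].
apply: (@g_sigma_algebra_measure_unique _ _ _ G mG (fun=> setT)) => //.
- by move=> _; exists (fun=> +oo); apply/seteqP; split => y // _ j /=; rewrite leey.
- by rewrite bigcup_const.
- move=> _ _ [x1 ->] [x2 ->]; exists (fun j => mine (x1 j) (x2 j)).
  apply/seteqP; split => y /=.
    by move=> [h1 h2] j; rewrite le_min h1 h2.
  by move=> h; split => j; move: (h j); rewrite le_min => /andP[].
- move=> _ [x ->].
  have pre (W' : Type) (Y : T -> W' -> \bar R) :
      (fun w => [tuple Y (t i) w | i < n]) @^-1`
        [set y : n.-tuple (\bar R) | forall j, tnth y j <= x j] =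
      [set w | forall j, Y (t j) w <= x j].
    by apply/seteqP; split => w /= h j; move: (h j); rewrite tnth_mktuple.
  by have := cdf n t x; rewrite -!pre.
- by move=> _; rewrite -[X in X < _]/(P1 setT) probability_setT ltry.
- exact: g_sigma_tuple_rays.
Qed.

End fdd.

(** * Products, limits and integrals of functions with values in the unit interval *)

Section ereal_aux.
Context {R : realType}.

Lemma prode_ge0_le1 (I : Type) (s : seq I) (a : I -> \bar R) :
  (forall i, 0 <= a i <= 1) -> 0 <= \prod_(i <- s) a i <= 1.
Proof.
move=> a01; elim/big_ind : _ => [|x y /andP[x0 x1] /andP[y0 y1]|i _].
- by rewrite lee01 lexx.
- by rewrite mule_ge0//= -[leRHS]mule1 lee_pmul.
- exact: a01.
Qed.

Lemma emeasurable_prod d (V : measurableType d) (I : Type) (s : seq I)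
    (h : I -> V -> \bar R) :
  (forall i, measurable_fun setT (h i)) ->
  measurable_fun setT (fun v => \prod_(i <- s) h i v).
Proof.
move=> mh; elim: s => [|i s ih].
  by under eq_fun do rewrite big_nil; exact: measurable_cst.
by under eq_fun do rewrite big_cons; exact: emeasurable_funM.
Qed.

Lemma cvg_prode_le1 (I : Type) (s : seq I) (a : I -> nat -> \bar R)
    (b : I -> \bar R) :
  (forall i n, 0 <= a i n <= 1) -> (forall i, 0 <= b i <= 1) ->
  (forall i, a i n @[n --> \oo] --> b i) ->
  (\prod_(i <- s) a i n) @[n --> \oo] --> \prod_(i <- s) b i.
Proof.
move=> a01 b01 ab; elim: s => [|i s ih].
  by under eq_fun do rewrite big_nil; rewrite big_nil; exact: cvg_cst.
under eq_fun do rewrite big_cons; rewrite big_cons; apply: cvgeM => //.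
have fin (x : \bar R) : 0 <= x <= 1 -> x \is a fin_num.
  by move=> /andP[x0 x1]; rewrite ge0_fin_numE// (le_lt_trans x1) ?ltry.
by apply: mule_def_fin; rewrite ?fin// prode_ge0_le1.
Qed.

Lemma cvg_integral_le1 d (V : measurableType d) (Q : probability V R)
    (f_ : (V -> \bar R)^nat) (f : V -> \bar R) :
  (forall n, measurable_fun setT (f_ n)) -> measurable_fun setT f ->
  (forall n v, 0 <= f_ n v <= 1) ->
  (forall v, f_ n v @[n --> \oo] --> f v) ->
  \int[Q]_v f_ n v @[n --> \oo] --> \int[Q]_v f v.
Proof.
move=> mf_ mf f01 cf.
have [] := @dominated_convergence _ _ _ Q setT measurableT f_ f (cst 1) mf_ mf.
- by apply: aeW => v _; exact: cf.
- exact: (finite_measure_integrable_cst Q 1%R).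
- apply: aeW => v n _ /=.
  by have /andP[h0 h1] := f01 n v; rewrite gee0_abs.
- done.
Qed.

(** At [l = -oo] this says that a product of numbers in the unit interval
vanishes in the limit when the sum of their logarithms diverges. *)
Lemma cvg_expeR (u : (\bar R)^nat) (l : \bar R) : l < +oo ->
  u n @[n --> \oo] --> l -> expeR (u n) @[n --> \oo] --> expeR l.
Proof.
case: l => [l _|//|_].
  move=> /fine_cvgP[fu cu] /=.
  apply/fine_cvgP; split.
    by apply: filterS fu => n; case: (u n).
  apply: (@cvg_trans _ (expR (fine (u n)) @[n --> \oo])).
    apply: near_eq_cvg; apply: filterS fu => n /=.
    by case: (u n) => [r||] //=.
  by apply: continuous_cvg => //; exact: continuous_expR.
move=> /cvgeNyPle uNy /=; apply/fine_cvgP; split.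
  by apply: filterS (uNy 0%R) => n; case: (u n).
apply/cvgrPdist_le => e e0; apply: filterS (uNy (ln e)) => n /=.
case: (u n) => [r|//|_] /=; last by rewrite sub0r normrN normr0 ltW.
by rewrite lee_fin sub0r normrN ger0_norm ?expR_ge0// -ler_expR lnK.
Qed.

End ereal_aux.

Lemma sigma_of_measurable d (W : measurableType d) (J : Type)
    d' (U : measurableType d') (X : J -> W -> U) G :
  (forall j, measurable_fun setT (X j)) -> sigma_of X G -> measurable G.
Proof.
move=> mX; apply: smallest_sub; first exact: sigma_algebra_measurable.
by move=> _ [i [B [mB ->]]]; rewrite -[X in measurable X]setTI; exact: mX.
Qed.

(** * Independent marks evaluated at levels that depend on the points *)

Section round_down.
Context {R : realType}.
Implicit Types (m : nat) (p : R).

(** Rounding down to the grid of mesh [1 / m.+1] goes through a natural number,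
because a partition into countably many pieces is handled below as a sequence
of sets. *)
Definition grid_index m p : nat := pickle (Num.floor (p * m.+1%:R)).

Definition grid_point m (k : nat) : R :=
  (odflt 0%R (unpickle k : option int))%:~R / m.+1%:R.

Lemma grid_pointE m p :
  grid_point m (grid_index m p) = ((Num.floor (p * m.+1%:R))%:~R / m.+1%:R)%R.
Proof. by rewrite /grid_point /grid_index pickleK. Qed.

Lemma measurable_grid_index m : measurable_fun setT (grid_index m).
Proof.
move=> _ B _; rewrite setTI.
rewrite (_ : _ @^-1` B = \bigcup_(k in B) (grid_index m @^-1` [set k])); last first.
  apply/seteqP; split => p /=; first by move=> ?; exists (grid_index m p).
  by move=> [k Bk /= ->].
apply: bigcup_measurable => k _.
case: (pselect (exists z : int, k = pickle z)) => [[z ->]|nz]; last first.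
  rewrite (_ : _ @^-1` _ = set0)// -subset0 => p /= pk.
  by apply: nz; eexists; exact: esym pk.
have -> : grid_index m @^-1` [set pickle z] =
    (fun p => p * m.+1%:R)%R @^-1` `[z%:~R, (z + 1)%:~R[%classic.
  apply/seteqP; split => p /=; rewrite /grid_index in_itv/= -floor_eq.
    by move=> /(pcan_inj pickleK) ->.
  by move=> /eqP ->.
by rewrite -[X in measurable X]setTI; apply: (mulrr_measurable _).
Qed.

Lemma grid_point_le m p : (grid_point m (grid_index m p) <= p)%R.
Proof. by rewrite grid_pointE ler_pdivrMr// floor_le. Qed.

Lemma cvg_grid_point p : grid_point m (grid_index m p) @[m --> \oo] --> p.
Proof.
apply/cvgrPdist_le => e e0.
near=> m.
rewrite ger0_norm ?subr_ge0 ?grid_point_le// lerBlDl grid_pointE.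
have m0 : (0 < m.+1%:R :> R)%R by [].
rewrite -lerBlDr ler_pdivlMr// mulrBl.
apply: (@le_trans _ _ (p * m.+1%:R - 1)%R).
  rewrite lerD2l lerN2 -ler_pdivrMr// div1r.
  by apply: ltW; near: m; exact: (near_infty_natSinv_lt (PosNum e0)).
by rewrite lerBlDr ltW//; have := floorD1_gt (p * m.+1%:R)%R; rewrite intrD.
Unshelve. all: by end_near.
Qed.

End round_down.

Section marks.
Context {R : realType} (dV : measure_display) (V : measurableType dV).
Context (Q : probability V R) (dE : measure_display) (E : measurableType dE).
Context (M : Type) (F : set (set M)).
Context (X : nat -> V -> E) (Y : nat -> V -> M).
Context (kap : E -> set M -> \bar R).

Hypothesis mX : forall i, measurable_fun setT (X i).
Hypothesis mY : forall i A, F A -> measurable (Y i @^-1` A).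
Hypothesis kap01 : forall e A, F A -> 0 <= kap e A <= 1.
Hypothesis mkap : forall A, F A -> measurable_fun setT (kap ^~ A).
Hypothesis marksE : forall (n : nat) (A : 'I_n -> set M) (G : set V),
  (forall i, F (A i)) -> sigma_of X G ->
  Q (G `&` \bigcap_(i in [set: 'I_n]) (Y i @^-1` A i)) =
  \int[Q]_(v in G) \prod_(i < n) kap (X i v) (A i).

Lemma measurable_mark_at_index (c : E -> nat) : measurable_fun setT c ->
  forall i (B : nat -> set M), (forall k, F (B k)) ->
  measurable [set v | B (c (X i v)) (Y i v)].
Proof.
move=> mc i B FB.
rewrite (_ : [set v | _] =
  \bigcup_k ((c \o X i) @^-1` [set k] `&` (Y i @^-1` B k))); last first.
  apply/seteqP; split => v /=; first by exists (c (X i v)).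
  by move=> [k _ [/= ->]].
apply: bigcupT_measurable => k; apply: measurableI; last exact: mY.
by rewrite -[X in measurable X]setTI; exact: (measurableT_comp mc).
Qed.

Lemma measurable_kap_at_index (c : E -> nat) : measurable_fun setT c ->
  forall (B : nat -> set M), (forall k, F (B k)) ->
  measurable_fun setT (fun e => kap e (B (c e))).
Proof.
move=> mc B FB.
have <- : \bigcup_k (c @^-1` [set k]) = setT :> set E.
  by apply/seteqP; split => // e _; exists (c e).
apply/measurable_fun_bigcup => k.
  by rewrite -[X in measurable X]setTI; exact: mc.
apply: (eq_measurable_fun (kap ^~ (B k))) => [e|].
  by rewrite inE /= => ->.
exact: measurable_funTS (mkap (FB k)).
Qed.

(** The hypothesis [marksE] concerns sets of marks that do not depend on the
points.  When the [i]-th set depends on the point [X i] through a label with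
countably many values, the coordinates are treated one after the other: cutting
[G] along the label of one point keeps it in the sigma-algebra of the points,
and on each piece the set of that coordinate is constant.  The induction is on
the number of coordinates whose set still varies. *)
Lemma marks_at_index (n : nat) (c : E -> nat) (mc : measurable_fun setT c)
    (B : 'I_n -> nat -> set M) (G : set V) :
  (forall i k, F (B i k)) -> sigma_of X G ->
  Q (G `&` \bigcap_(i in [set: 'I_n]) [set v | B i (c (X i v)) (Y i v)]) =
  \int[Q]_(v in G) \prod_(i < n) kap (X i v) (B i (c (X i v))).
Proof.
move=> FB sG.
suff H m : forall (B : 'I_n -> nat -> set M) (G : set V),
    (forall i k, F (B i k)) -> sigma_of X G ->
    (forall i : 'I_n, (m <= i)%N -> forall k, B i k = B i 0%N) ->
    Q (G `&` \bigcap_(i in [set: 'I_n]) [set v | B i (c (X i v)) (Y i v)]) =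
    \int[Q]_(v in G) \prod_(i < n) kap (X i v) (B i (c (X i v))).
  by apply: (H n) => // i; rewrite leqNgt ltn_ord.
elim: m => [|m ih] {}B {}G {}FB {}sG cB.
  under eq_integral do under eq_bigr do rewrite cB//.
  rewrite -(marksE (A := fun i => B i 0%N))//; congr (Q (_ `&` _)).
  by apply: eq_bigcapr => i _; apply/seteqP; split => v /=; rewrite cB.
have [nm|mn] := leqP n m.
  by apply: ih => // i mi; move: (leq_trans nm mi); rewrite leqNgt ltn_ord.
pose j := Ordinal mn.
pose Gk k := G `&` (c \o X j) @^-1` [set k].
pose Bk k i l := if i == j then B j k else B i l.
pose D := \bigcap_(i in [set: 'I_n]) [set v | B i (c (X i v)) (Y i v)].
have GE : G = \bigcup_k Gk k.
  apply/seteqP; split => v; first by exists (c (X j v)).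
  by move=> [k _ []].
have sGk k : sigma_of X (Gk k).
  apply: (@measurableI _ (g_sigma_algebraType _)) => //.
  apply: sub_sigma_algebra; exists j, (c @^-1` [set k]); split => //.
  by rewrite -[X in measurable X]setTI; exact: mc.
have tGk : trivIset setT Gk.
  apply/trivIsetP => k l _ _ /eqP kl; rewrite -subset0 => v [[_ /= vk] [_ /= vl]].
  by apply: kl; rewrite -vk.
have FBk k i l : F (Bk k i l) by rewrite /Bk; case: ifP.
have mD : measurable D.
  by apply: fin_bigcap_measurable => // i _;
    exact: (measurable_mark_at_index mc _ (FB i)).
have mG := sigma_of_measurable mX sG.
have mGk k := sigma_of_measurable mX (sGk k).
have E1 : Q (G `&` D) = \sum_(k <oo) Q (Gk k `&` D).
  rewrite {1}GE setI_bigcupl measure_bigcup//.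
  - by apply: eq_eseriesl => k; rewrite in_setT.
  - by move=> k _; exact: measurableI.
  - exact: trivIset_setIr.
rewrite E1 [in RHS]GE ge0_integral_bigcup//; last 2 first.
- rewrite -GE; apply: measurable_funTS; apply: emeasurable_prod => i.
  apply: (measurableT_comp (f := fun e => kap e (B i (c e)))) => //.
  exact: (measurable_kap_at_index mc (FB i)).
- by move=> v _; apply: (andP (prode_ge0_le1 _ _)).1 => i; exact: kap01.
apply: eq_eseriesr => k _.
transitivity (Q (Gk k `&` \bigcap_(i in [set: 'I_n])
    [set v | Bk k i (c (X i v)) (Y i v)])).
  congr (Q _); apply/seteqP; split => v [Gv Dv]; split=> // i _ /=.
    rewrite /Bk; case: eqP => [->|_]; last exact: Dv.
    by case: Gv => _ /= <-; have := Dv j I.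
  have := Dv i I; rewrite /= /Bk; case: eqP => [->|//].
  by case: Gv => _ /= ->.
rewrite ih//.
  apply: eq_integral => v /set_mem[_ /= vk]; apply: eq_bigr => i _.
  by rewrite /Bk; case: eqP => [->|//]; rewrite vk.
move=> i; rewrite leq_eqVlt /Bk; case: (i =P j) => // ij /orP[/eqP mi|mi] l.
  by exfalso; apply: ij; exact: val_inj.
exact: cB.
Qed.

(** The sets [C p] are continuous from the left in [p] for single marks
([nearC]) and for the kernel ([cvgC]); rounding [r] down to finer and finer
grids therefore reduces sets [C (r (X i))] to sets depending on a label. *)
Section thresholds.
Variables (C : R -> set M) (r : E -> R).
Hypothesis FC : forall p, F (C p).
Hypothesis mr : measurable_fun setT r.
Hypothesis nearC : forall (q : nat -> R) p f, (forall m, q m <= p)%R ->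
  q m @[m --> \oo] --> p -> \forall m \near \oo, C (q m) f <-> C p f.
Hypothesis cvgC : forall (q : nat -> R) p e, (forall m, q m <= p)%R ->
  q m @[m --> \oo] --> p -> kap e (C (q m)) @[m --> \oo] --> kap e (C p).

Let rd m e : R := grid_point m (grid_index m (r e)).

Let measurable_index_r m : measurable_fun setT (grid_index m \o r).
Proof. exact: measurableT_comp (@measurable_grid_index _ m) mr. Qed.

Let measurable_kap_rd m : measurable_fun setT (fun e => kap e (C (rd m e))).
Proof.
by apply: (measurable_kap_at_index (measurable_index_r m)
  (B := fun k => C (grid_point m k))).
Qed.

Lemma measurable_kap_threshold : measurable_fun setT (fun e => kap e (C (r e))).
Proof.
apply: (emeasurable_fun_cvg _ _ measurable_kap_rd) => e _.
by apply: cvgC => [m|]; [exact: grid_point_le|exact: cvg_grid_point].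
Qed.

Let below n m := \bigcap_(i in [set: 'I_n]) [set v | C (rd m (X i v)) (Y i v)].
Let below_lim n := \bigcap_(i in [set: 'I_n]) [set v | C (r (X i v)) (Y i v)].

Let measurable_below n m : measurable (below n m).
Proof.
apply: fin_bigcap_measurable => // i _.
exact: (measurable_mark_at_index (measurable_index_r m) i
  (B := fun k => C (grid_point m k))).
Qed.

Let near_below n v : \forall m \near \oo, below n m v <-> below_lim n v.
Proof.
have : \forall m \near \oo, forall i : 'I_n,
    C (rd m (X i v)) (Y i v) <-> C (r (X i v)) (Y i v).
  apply: filter_forall => i.
  by apply: nearC => [m|]; [exact: grid_point_le|exact: cvg_grid_point].
apply: filterS => m h.
by split => H i _; [apply/(h i).1|apply/(h i).2]; exact: H.
Qed.

Lemma measurable_below_lim n : measurable (below_lim n).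
Proof.
have -> : below_lim n = \bigcup_m \bigcap_(k >= m) below n k.
  apply/seteqP; split => v.
    have [m _ h] := near_below n v.
    by move=> bv; exists m => // k /= mk; apply/(h k mk).2.
  have [m _ h] := near_below n v; move=> [m' _ b].
  by apply/(h (maxn m m') (leq_maxl _ _)).1; apply: b; exact: leq_maxr.
apply: bigcupT_measurable => m; apply: bigcap_measurable => //.
by exists m => /=.
Qed.

Lemma marks_below n :
  Q (below_lim n) = \int[Q]_v \prod_(i < n) kap (X i v) (C (r (X i v))).
Proof.
have below_int m : \int[Q]_v (\1_(below n m) v)%:E =
    \int[Q]_v \prod_(i < n) kap (X i v) (C (rd m (X i v))).
  rewrite integral_indic// setIT -[below n m]setTI.
  apply: (marks_at_index (measurable_index_r m)
    (B := fun i k => C (grid_point m k))) => //.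
  exact: (@measurableT _ (g_sigma_algebraType _)).
have mk (h : E -> \bar R) : measurable_fun setT h ->
    measurable_fun setT (fun v => \prod_(i < n) h (X i v)).
  by move=> mh; apply: emeasurable_prod => i; exact: measurableT_comp.
have c1 : \int[Q]_v (\1_(below n m) v)%:E @[m --> \oo] --> Q (below_lim n).
  have -> : Q (below_lim n) = \int[Q]_v (\1_(below_lim n) v)%:E.
    by rewrite integral_indic ?setIT//; exact: measurable_below_lim.
  apply: cvg_integral_le1.
  - by move=> m; apply/measurable_EFinP; exact: measurable_indic.
  - by apply/measurable_EFinP; apply: measurable_indic; exact: measurable_below_lim.
  - by move=> m v; rewrite !lee_fin indicE ler0n lern1 leq_b1.
  - move=> v; apply: cvg_near_cst; apply: filterS (near_below n v) => m h.
    rewrite !indicE; congr (_%:R%:E); congr nat_of_bool.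
    by apply/idP/idP; rewrite !inE => /h.
have c2 : \int[Q]_v \prod_(i < n) kap (X i v) (C (rd m (X i v))) @[m --> \oo]
    --> \int[Q]_v \prod_(i < n) kap (X i v) (C (r (X i v))).
  apply: cvg_integral_le1.
  - by move=> m; apply: (mk _ (measurable_kap_rd m)).
  - exact: (mk _ measurable_kap_threshold).
  - by move=> m v; apply: prode_ge0_le1 => i; exact: kap01.
  - move=> v; apply: cvg_prode_le1 => [i m|i|i].
    + exact: kap01.
    + exact: kap01.
    + by apply: cvgC => [m|]; [exact: grid_point_le|exact: cvg_grid_point].
rewrite (eq_fun below_int) in c1.
exact: cvg_unique c1 c2.
Qed.

(** The product over the points is written as the exponential of minus a sum,
which is the form in which the Laplace functional evaluates it; a factor 0
contributes [+oo] to the sum. *)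
Lemma marks_below_all :
  Q [set v | forall i, C (r (X i v)) (Y i v)] =
  \int[Q]_v expeR (- \sum_(i <oo) - lne (kap (X i v) (C (r (X i v))))).
Proof.
pose g e := kap e (C (r e)).
have g01 e : 0 <= g e <= 1 by exact: kap01.
have lng e : 0 <= - lne (g e).
  by rewrite oppe_ge0 lne_le0; case/andP: (g01 e).
have allE : [set v | forall i, C (r (X i v)) (Y i v)] = \bigcap_n below_lim n.
  apply/seteqP; split => v /= h; first by move=> n _ i _; exact: h.
  by move=> i; apply: (h i.+1 I (Ordinal (ltnSn i)) I).
have c1 : Q (below_lim n) @[n --> \oo] --> Q [set v | forall i, C (r (X i v)) (Y i v)].
  rewrite allE; apply: nonincreasing_cvg_mu.
  - by rewrite (le_lt_trans (probability_le1 _ _)) ?ltry//; exact: measurable_below_lim.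
  - by move=> i; exact: measurable_below_lim.
  - by apply: bigcapT_measurable => i; exact: measurable_below_lim.
  - move=> m n mn; apply/subsetPset => v h i _.
    exact: (h (widen_ord mn i) I).
have prodE n v : \prod_(i < n) g (X i v) =
    expeR (- \sum_(0 <= i < n) - lne (g (X i v))).
  elim: n => [|n ih]; first by rewrite big_ord0 big_nil oppe0 expeR0.
  rewrite big_ord_recr big_nat_recr//= ih oppeD; last first.
    by apply: ge0_adde_def; rewrite inE ?sume_ge0.
  rewrite oppeK expeRD lneK// in_itv/= leey andbT.
  by case/andP: (g01 (X n v)).
have c2 : \int[Q]_v \prod_(i < n) g (X i v) @[n --> \oo] -->
   \int[Q]_v expeR (- \sum_(i <oo) - lne (g (X i v))).
  have mprod n : measurable_fun setT (fun v => \prod_(i < n) g (X i v)).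
    apply: emeasurable_prod => i.
    by apply: (measurableT_comp (f := g)) => //; exact: measurable_kap_threshold.
  have cprod v : \prod_(i < n) g (X i v) @[n --> \oo] -->
      expeR (- \sum_(i <oo) - lne (g (X i v))).
    under eq_fun do rewrite prodE.
    apply: cvg_expeR.
      by rewrite lteNl /= (lt_le_trans (ltNyr 0%R))// nneseries_ge0.
    by apply: cvgeN; exact: is_cvg_nneseries.
  apply: cvg_integral_le1 => //.
  - exact: (emeasurable_fun_cvg _ _ mprod).
  - by move=> n v; exact: prode_ge0_le1.
rewrite (eq_fun marks_below) in c1.
exact: cvg_unique c1 c2.
Qed.

End thresholds.
End marks.

(** * Expectation of a product of independent variables *)

Section measurable_expeR.
Context {R : realType}.

(** Half-lines are pulled back to half-lines, since the exponential is
increasing with inverse the logarithm on nonnegative numbers. *)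
Lemma measurable_expeR : measurable_fun setT (@expeR R).
Proof.
apply: (measurability _ (ErealGenOInfty.measurableE R)) => _ [_ [r ->] <-].
rewrite setTI; have [r0|r0] := ltP r 0%R.
  rewrite (_ : _ @^-1` _ = setT)//; apply/seteqP; split => // x _ /=.
  by rewrite in_itv/= andbT (lt_le_trans _ (expeR_ge0 x))// lte_fin.
rewrite (_ : _ @^-1` _ = setT `&` [set x | lne r%:E < id x]).
  by apply: emeasurable_fun_o_infty.
have h x : (r%:E < expeR x) = (lne r%:E < x).
  by rewrite -{1}(lneK (x := r%:E)) ?lte_expeR// in_itv/= lee_fin r0 leey.
by apply/seteqP; split => x /=; rewrite in_itv/= andbT h => //; case.
Qed.

Lemma measurable_lne : measurable_fun setT (@lne R).
Proof.
apply: (measurability _ (ErealGenOInfty.measurableE R)) => _ [_ [r ->] <-].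
rewrite setTI (_ : _ @^-1` _ = setT `&` [set x | expeR r%:E < id x]).
  by apply: emeasurable_fun_o_infty.
have h x : (r%:E < lne x) = (expeR r%:E < x).
  have [x0|x0] := ltP x 0.
    rewrite le0_lneNy ?ltW// ltNge leNye/=; apply/esym/negbTE.
    by rewrite -leNgt (le_trans (ltW x0))// lee_fin expR_ge0.
  by rewrite -{2}(lneK (x := x)) ?lte_expeR// in_itv/= x0 leey.
by apply/seteqP; split => x /=; rewrite in_itv/= andbT h => //; case.
Qed.

End measurable_expeR.

Section product_of_expectations.
Context {R : realType} (dV : measure_display) (V : measurableType dV).
Context (Q : probability V R).

Import HBNNSimple.

(** Both sides are additive and continuous along increasing sequences in [h],
so agreement on indicators extends to simple functions and to their monotone
limits. *)
Lemma integral_indic_ext (Y : V -> \bar R) (c : \bar R)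
    d (T : measurableType d) (N : V -> T) (h : T -> \bar R) :
  measurable_fun setT Y -> (forall v, 0 <= Y v <= 1) -> 0 <= c <= 1 ->
  measurable_fun setT N ->
  (forall A, measurable A -> \int[Q]_v (Y v * (\1_A (N v))%:E) = c * Q (N @^-1` A)) ->
  measurable_fun setT h -> (forall x, 0 <= h x) ->
  \int[Q]_v (Y v * h (N v)) = c * \int[Q]_v h (N v).
Proof.
move=> mY Y01 c01 mN YA mh h0.
have fin01 (x : \bar R) : 0 <= x <= 1 -> x \is a fin_num.
  by move=> /andP[x0 x1]; rewrite ge0_fin_numE// (le_lt_trans x1) ?ltry.
have Y0 v : 0 <= Y v by case/andP: (Y01 v).
have c0 : 0 <= c by case/andP: c01.
pose h_ n := nnsfun_approx measurableT mh n.
have mhN n : measurable_fun setT (fun v => (h_ n (N v))%:E).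
  by apply/measurable_EFinP; apply: measurableT_comp.
have ndh v : {homo (fun n => (h_ n (N v))%:E) : m n / (m <= n)%N >-> m <= n}.
  by move=> m n mn; rewrite lee_fin; exact/lefP/nd_nnsfun_approx.
have ch v : (h_ n (N v))%:E @[n --> \oo] --> h (N v).
  by apply: cvg_nnsfun_approx.
have hE n v : (h_ n (N v))%:E =
    \sum_(y \in range (h_ n)) (y * \1_(h_ n @^-1` [set y]) (N v))%:E.
  by rewrite {1}fimfunE -fsumEFin.
have mind (A : set T) : measurable A ->
    measurable_fun setT (fun v => (\1_A (N v) : R)%:E).
  by move=> mA; apply/measurable_EFinP; apply: measurableT_comp => //;
    exact: measurable_indic.
have muleYge0 n y v :
    0 <= Y v * (y * \1_(h_ n @^-1` [set y]) (N v))%:E.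
  by rewrite mule_ge0// EFinM nnfun_muleindic_ge0.
have mA n y : measurable (h_ n @^-1` [set y]) by exact: measurable_sfunP.
have YhE n v : Y v * (h_ n (N v))%:E =
    \sum_(y \in range (h_ n)) Y v * (y * \1_(h_ n @^-1` [set y]) (N v))%:E.
  by rewrite hE ge0_mule_fsumr// => y; rewrite EFinM nnfun_muleindic_ge0.
have step n : \int[Q]_v (Y v * (h_ n (N v))%:E) = c * \int[Q]_v (h_ n (N v))%:E.
  under eq_integral do rewrite YhE.
  under [in RHS]eq_integral do rewrite hE.
  rewrite ge0_integral_fsum//; last first.
    move=> y; apply: emeasurable_funM => //; under eq_fun do rewrite EFinM.
    by apply: emeasurable_funM => //; exact: mind.
  rewrite ge0_integral_fsum//; last 2 first.
  - move=> y; under eq_fun do rewrite EFinM.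
    by apply: emeasurable_funM => //; exact: mind.
  - by move=> y v _; rewrite EFinM nnfun_muleindic_ge0.
  rewrite ge0_mule_fsumr; last first.
    by move=> y; apply: integral_ge0 => v _; rewrite EFinM nnfun_muleindic_ge0.
  apply: eq_fsbigr => y /set_mem[x _ xy].
  have y0 : (0 <= y)%R by rewrite -xy.
  under eq_integral do rewrite EFinM muleCA.
  rewrite ge0_integralZl_EFin//; last 2 first.
  - by move=> v _; rewrite mule_ge0// lee_fin.
  - by apply: emeasurable_funM => //; exact: mind.
  under [in RHS]eq_integral do rewrite EFinM.
  rewrite ge0_integralZl_EFin//; last exact: mind.
  rewrite YA// muleCA; congr (_ * (_ * _)).
  have mNA : measurable (N @^-1` (h_ n @^-1` [set y])).
    by rewrite -[X in measurable X]setTI; exact: mN.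
  by rewrite (_ : Q _ = \int[Q]_v (\1_(N @^-1` (h_ n @^-1` [set y])) v)%:E)
    ?integral_indic ?setIT.
have c1 : \int[Q]_v (Y v * (h_ n (N v))%:E) @[n --> \oo] -->
    \int[Q]_v (Y v * h (N v)).
  have -> : \int[Q]_v (Y v * h (N v)) =
      \int[Q]_v limn (fun n => Y v * (h_ n (N v))%:E).
    apply: eq_integral => v _; apply/esym/cvg_lim => //.
    by apply: cvgeZl => //; exact: fin01.
  apply: cvg_monotone_convergence => //.
  - by move=> n; exact: emeasurable_funM.
  - by move=> n v _; rewrite mule_ge0// lee_fin.
  - by move=> v _ m n mn; rewrite lee_wpmul2l//; exact: ndh.
have c2 : c * \int[Q]_v (h_ n (N v))%:E @[n --> \oo] --> c * \int[Q]_v h (N v).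
  apply: cvgeZl; first exact: fin01.
  have -> : \int[Q]_v h (N v) = \int[Q]_v limn (fun n => (h_ n (N v))%:E).
    by apply: eq_integral => v _; apply/esym/cvg_lim.
  apply: cvg_monotone_convergence => //.
  by move=> n v _; rewrite lee_fin.
rewrite (eq_fun step) in c1.
exact: cvg_unique c1 c2.
Qed.

(** Independence is the case of indicators.  They are replaced by the functions
[h i] one at a time, each replacement being an instance of
[integral_indic_ext] in which the other factors play the part of [Y]. *)
Lemma mutually_independent_integral (I : eqType) (N : I -> V -> \bar R)
    (h : I -> \bar R -> \bar R) (s : seq I) :
  (forall i, measurable_fun setT (N i)) ->
  mutually_independent Q (fun i => preimage_set_system setT (N i) measurable) ->
  (forall i, measurable_fun setT (h i)) -> (forall i x, 0 <= h i x <= 1) ->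
  uniq s ->
  \int[Q]_v \prod_(i <- s) h i (N i v) = \prod_(i <- s) \int[Q]_v h i (N i v).
Proof.
move=> mN indep mh h01 us.
have mhN i : measurable_fun setT (fun v => h i (N i v)).
  exact: measurableT_comp.
have inth01 i : 0 <= \int[Q]_v h i (N i v) <= 1.
  apply/andP; split.
    by apply: integral_ge0 => v _; case/andP: (h01 i (N i v)).
  rewrite -[leRHS](@probability_setT _ _ _ Q) -[leRHS]mul1e -integral_cst//.
  apply: ge0_le_integral => //.
  - by move=> v _; case/andP: (h01 i (N i v)).
  - by move=> v _; case/andP: (h01 i (N i v)).
suff H s1 s2 (A : I -> set (\bar R)) : uniq (s1 ++ s2) ->
    (forall i, measurable (A i)) ->
    \int[Q]_v (\prod_(i <- s1) h i (N i v) *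
      (\1_(\bigcap_(i in [set` s2]) (N i @^-1` A i)) v)%:E) =
    \prod_(i <- s1) \int[Q]_v h i (N i v) * \prod_(i <- s2) Q (N i @^-1` A i).
  have := H s [::] (fun=> setT); rewrite cats0 big_nil mule1 => <- //.
  apply: eq_integral => v _.
  by rewrite set_nil bigcap_set0 indicT mule1.
have mNA i B : measurable B -> measurable (N i @^-1` B).
  by move=> mB; rewrite -[X in measurable X]setTI; exact: mN.
(* [s1] lists the coordinates that already carry a function, [s2] those that
   still carry an indicator. *)
elim: s1 s2 A => [|i s1 ih] s2 A us12 mA.
  rewrite big_nil mul1e; under eq_integral do rewrite big_nil mul1e.
  have mcap : measurable (\bigcap_(i in [set` s2]) (N i @^-1` A i)).
    by apply: fin_bigcap_measurable => // i _; exact: mNA.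
  rewrite integral_indic// setIT.
  apply: (indep s2 (fun i => N i @^-1` A i)) => // i _.
  by exists (A i) => //; rewrite setTI.
have us1i : uniq (s1 ++ i :: s2).
  by rewrite (perm_uniq (_ : perm_eq _ (i :: s1 ++ s2)))// perm_catC/= perm_cons perm_catC.
pose Y v := \prod_(j <- s1) h j (N j v) *
      (\1_(\bigcap_(j in [set` s2]) (N j @^-1` A j)) v)%:E.
pose c := \prod_(j <- s1) \int[Q]_v h j (N j v) * \prod_(j <- s2) Q (N j @^-1` A j).
have ins2 : i \notin s2.
  by move: us12; rewrite cat_cons /= mem_cat negb_or => /andP[/andP[]].
have -> : \int[Q]_v (\prod_(j <- i :: s1) h j (N j v) *
      (\1_(\bigcap_(j in [set` s2]) (N j @^-1` A j)) v)%:E) =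
    \int[Q]_v (Y v * h i (N i v)).
  by apply: eq_integral => v _; rewrite big_cons /Y [h i _ * _]muleC muleAC.
have mule01 (x y : \bar R) : 0 <= x <= 1 -> 0 <= y <= 1 -> 0 <= x * y <= 1.
  by move=> /andP[x0 x1] /andP[y0 y1]; rewrite mule_ge0//= -[leRHS]mule1 lee_pmul.
have mcap (t : seq I) (B : I -> set (\bar R)) : (forall j, measurable (B j)) ->
    measurable (\bigcap_(j in [set` t]) (N j @^-1` B j)).
  by move=> mB; apply: fin_bigcap_measurable => // j _; exact: mNA.
rewrite (@integral_indic_ext Y c)//.
- by rewrite big_cons -[RHS]muleA [RHS]muleC.
- apply: emeasurable_funM; first exact: emeasurable_prod.
  by apply/measurable_EFinP; apply: measurable_indic; exact: mcap.
- move=> v; apply: mule01; first exact: prode_ge0_le1.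
  by rewrite !lee_fin indicE ler0n lern1 leq_b1.
- apply: mule01; first exact: prode_ge0_le1.
  by apply: prode_ge0_le1 => j; rewrite measure_ge0 probability_le1//; exact: mNA.
- move=> B mB; pose A' j := if j == i then B else A j.
  have A's2 j : j \in s2 -> A' j = A j.
    by rewrite /A'; case: eqP => // -> is2; rewrite is2 in ins2.
  have A'i : A' i = B by rewrite /A' eqxx.
  have mA' j : measurable (A' j) by rewrite /A'; case: eqP.
  have -> : c * Q (N i @^-1` B) = \prod_(j <- s1) \int[Q]_v h j (N j v) *
      \prod_(j <- i :: s2) Q (N j @^-1` A' j).
    rewrite big_cons A'i /c -muleA; congr (_ * _); rewrite muleC; congr (_ * _).
    by apply: eq_big_seq => j js2; rewrite A's2.
  rewrite -ih//.
  apply: eq_integral => v _; rewrite /Y -muleA; congr (_ * _).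
  rewrite -EFinM !indicE -natrM mulnb; congr (_%:R%:E); congr nat_of_bool.
  apply/andP/idP.
    move=> [/set_mem cap /set_mem NB]; apply/mem_set => j /=.
    rewrite inE => /predU1P[->|js2]; first by rewrite A'i.
    by rewrite A's2//; exact: cap.
  move=> /set_mem cap; split; apply/mem_set.
    by move=> j /= js2; rewrite -A's2//; apply: cap => /=; rewrite inE js2 orbT.
  by rewrite -A'i; apply: (cap i) => /=; rewrite inE eqxx.
- by move=> x; case/andP: (h01 i x).
Qed.

End product_of_expectations.

(** * The Laplace functional of a Poisson process *)

Section poisson_laplace.
Context {R : realType}.

(** For [b = - a] this is the total mass of the Poisson law; for [b = - l] and
[a = l * exp (- c)] it is the Laplace transform of the Poisson law of
parameter [l]. *)
Lemma eseries_exp (a b : R) : (0 <= a)%R ->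
  \sum_(0 <= k <oo) (expR b * (a ^+ k / k`!%:R))%:E = (expR (b + a))%:E.
Proof.
move=> a0; apply/cvg_lim => //.
under eq_fun do rewrite sumEFin -mulr_sumr.
rewrite expRD; apply: cvg_EFin; first exact: nearW.
apply: cvgMr; exact: is_cvg_series_exp_coeff.
Qed.

Lemma poisson_prob_set1 (l : R) (k : nat) : (0 <= l)%R ->
  poisson_prob l k [set k] = (expR (- l) * (l ^+ k / k`!%:R))%:E.
Proof.
rewrite /poisson_prob le_eqVlt => /predU1P[<-|l0].
  rewrite ltxx oppr0 expR0 mul1r diracE expr0n.
  case: k => [|k]; first by rewrite mem_set// divr1.
  by rewrite memNset// mul0r.
by rewrite l0 esum_set1 ?lee_fin ?poisson_pmf_ge0// /poisson_pmf l0 mulrC.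
Qed.

Context (dV : measure_display) (V : measurableType dV) (Q : probability V R).
Context (dE : measure_display) (E : measurableType dE).
Context (nu : {measure set E -> \bar R}) (rho : E -> R).
Context (X : nat -> V -> E).
Hypothesis rho0 : forall e, (0 <= rho e)%R.
Hypothesis mrho : measurable_fun setT rho.

Let Lam A := \int[nu]_(e in A) (rho e)%:E.

Hypothesis ppX : poisson_process Q X Lam.

Let mX i : measurable_fun setT (X i). Proof. by case: ppX. Qed.

Lemma measurable_point_count A : measurable A ->
  measurable_fun setT (point_count R X A).
Proof.
move=> mA; apply: (eq_measurable_fun
  (fun v => \sum_(0 <= i <oo | i \in xpredT) \d_(X i v) A)) => //.
apply: ge0_emeasurable_sum => // i _.
rewrite (_ : (fun v => _) = (fun v => (\1_A (X i v))%:E)).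
  by apply/measurable_EFinP; apply: measurableT_comp => //; exact: measurable_indic.
by apply/funext => v; rewrite diracE indicE.
Qed.

(** When the intensity of [A] is finite, the count is almost surely a natural
number, because the Poisson probabilities add up to 1, and the Laplace
transform of the Poisson law is summed explicitly.  When it is infinite, the
count is almost surely infinite; both sides are 0 if [c] is positive and 1
otherwise. *)
Lemma laplace_point_count A (c : R) : measurable A -> (0 <= c)%R ->
  \int[Q]_v expeR (- (c%:E * point_count R X A v)) =
  expeR (- ((1 - expR (- c))%:E * Lam A)).
Proof.
move=> mA c0; have mN := measurable_point_count mA.
have mexp : measurable_fun setT (fun v => expeR (- (c%:E * point_count R X A v))).
  apply: (measurableT_comp measurable_expeR).
  apply: (measurableT_comp (@oppe_measurable R setT)).
  exact: emeasurable_funM.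
have mNB B : measurable B -> measurable (point_count R X A @^-1` B).
  by move=> mB; rewrite -[X in measurable X]setTI; exact: mN.
have L0 : 0 <= Lam A by apply: integral_ge0 => e _; rewrite lee_fin.
have [_ countf county _] := ppX.
have [Ly|Ly] := eqVneq (Lam A) +oo.
  have [->|cn0] := eqVneq c 0%R.
    under eq_integral do rewrite mul0e oppe0 expeR0.
    rewrite oppr0 expR0 subrr mul0e oppe0 expeR0 integral_cst//.
    by rewrite mul1e; exact: probability_setT.
  have c_gt0 : (0 < c)%R by rewrite lt_neqAle eq_sym cn0.
  rewrite Ly gt0_muley; last by rewrite lte_fin subr_gt0 expR_lt1 oppr_lt0.
  rewrite [RHS]/= -[RHS](@integral0 _ _ _ Q setT).
  apply: ae_eq_integral => //.
  exists (~` [set v | point_count R X A v = +oo]); split.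
  - by apply: measurableC; exact: (mNB [set +oo]).
  - by rewrite -[LHS]/(Q (~` _)) probability_setC ?county ?subee//; exact: (mNB [set +oo]).
  - apply: subsetC => v /= -> _.
    by rewrite gt0_muley.
have Lfin : Lam A \is a fin_num by rewrite ge0_fin_numE// ltey.
have l0 : (0 <= fine (Lam A))%R by exact: fine_ge0.
pose D k := [set v | point_count R X A v = k%:R%:E].
have mD k : measurable (D k) by exact: (mNB [set k%:R%:E]).
have tD : trivIset setT D.
  apply/trivIsetP => k l _ _ /eqP kl; rewrite -subset0 => v [/= vk vl].
  by apply: kl; apply/eqP; move/eqP: vk; rewrite vl eqe eqr_nat eq_sym.
have QD k : Q (D k) = (expR (- fine (Lam A)) * (fine (Lam A) ^+ k / k`!%:R))%:E.
  by rewrite countf ?ltey// poisson_prob_set1.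
have mUD : measurable (\bigcup_k D k) by exact: bigcupT_measurable.
have QUD : Q (\bigcup_k D k) = 1.
  transitivity (\sum_(0 <= k <oo) Q (D k)).
    by rewrite measure_bigcup//; apply: eq_eseriesl => k; rewrite in_setT.
  under eq_eseriesr do rewrite QD.
  by rewrite eseries_exp// addNr expR0.
rewrite (ge0_negligible_integral (N := ~` \bigcup_k D k))//; last 3 first.
- exact: measurableC.
- by move=> v _; exact: expeR_ge0.
- by rewrite -[LHS]/(Q (~` _)) probability_setC// QUD subee.
rewrite setTD setCK ge0_integral_bigcup//; last 2 first.
- exact: measurable_funTS.
- by move=> v _; exact: expeR_ge0.
transitivity (\sum_(0 <= k <oo) (expR (- fine (Lam A)) *
    ((fine (Lam A) * expR (- c)) ^+ k / k`!%:R))%:E).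
  apply: eq_eseriesr => k _.
  transitivity (\int[Q]_(v in D k) (cst (expR (- (c * k%:R)))%:E v)).
    by apply: eq_integral => v /set_mem /= ->.
  rewrite integral_cst// -[X in _ * X]/(Q (D k)) QD -EFinM; congr _%:E.
  rewrite exprMn mulrC -!mulrA; congr (_ * (_ * _))%R.
  by rewrite mulrC -expRM_natr mulNr.
rewrite eseries_exp; last by rewrite mulr_ge0// expR_ge0.
rewrite -{3}(fineK Lfin) /=; congr (expR _)%:E.
by rewrite mulrBl mul1r opprB addrC mulrC.
Qed.

Import HBNNSimple.

Lemma expeRN_sum (I : Type) (s : seq I) (u : I -> \bar R) :
  (forall i, 0 <= u i) ->
  expeR (- \sum_(i <- s) u i) = \prod_(i <- s) expeR (- u i).
Proof.
move=> u0; elim: s => [|i s ih]; first by rewrite !big_nil oppe0 expeR0.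
rewrite !big_cons -ih -expeRD oppeD//.
by apply: ge0_adde_def; rewrite inE ?sume_ge0.
Qed.

(** Exactly one level set of [f] contains [e]. *)
Lemma nnsfun_level_sum (f : {nnsfun E >-> R}) (h : R -> \bar R) e :
  \sum_(y <- finmap.enum_fset (fset_set (range f)))
    h y * (\1_(f @^-1` [set y]) e)%:E = h (f e).
Proof.
rewrite (bigD1_seq (f e))//=; last 2 first.
- by rewrite in_fset_set//; apply/mem_set; exists e.
- exact: finmap.fset_uniq.
rewrite indicE mem_set//= mule1 big1 ?adde0// => y yf.
by rewrite indicE memNset ?mule0//= => fy; rewrite fy eqxx in yf.
Qed.

(** The sum of [f] over the points is a linear combination of the point counts
of the level sets of [f], which are disjoint, so the counts are independent. *)
Lemma laplace_nnsfun (f : {nnsfun E >-> R}) :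
  \int[Q]_v expeR (- \sum_(0 <= i <oo) (f (X i v))%:E) =
  expeR (- \int[nu]_e ((1 - expeR (- (f e)%:E)) * (rho e)%:E)).
Proof.
set s : seq R := finmap.enum_fset (fset_set (range f)).
pose A (k : 'I_(size s)) := f @^-1` [set s`_k].
have mA k : measurable (A k) by exact: measurable_sfunP.
have us : uniq s by exact: finmap.fset_uniq.
have c0 (k : 'I_(size s)) : (0 <= s`_k)%R.
  have : s`_k \in s by exact: mem_nth.
  by rewrite in_fset_set// => /set_mem[e _ <-].
have levels (h : R -> \bar R) e :
    h (f e) = \sum_(k < size s) h s`_k * (\1_(A k) e)%:E.
  by rewrite -(nnsfun_level_sum f h) (big_nth 0%R) big_mkord.
have tA : trivIset setT A.
  apply/trivIsetP => k l _ _ kl; rewrite -subset0 => e [/= ek el].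
  have /eqP : s`_k = s`_l by rewrite -ek -el.
  by rewrite nth_uniq// => /eqP/val_inj/eqP; rewrite (negbTE kl).
have sumE v : \sum_(0 <= i <oo) (f (X i v))%:E =
    \sum_(k < size s) (s`_k)%:E * point_count R X (A k) v.
  under eq_eseriesr do rewrite (levels EFin).
  rewrite nneseries_sum; last first.
    by move=> k i _; rewrite mule_ge0 ?lee_fin.
  apply: eq_bigr => k _; rewrite nneseriesZl; last by move=> i _; rewrite lee_fin.
  by congr (_ * _); apply: eq_eseriesr => i _; rewrite diracE indicE.
have cN0 (k : 'I_(size s)) v : 0 <= (s`_k)%:E * point_count R X (A k) v.
  by rewrite mule_ge0 ?lee_fin// nneseries_ge0.
have [_ _ _ indep] := ppX.
have mh (k : 'I_(size s)) : measurable_fun setT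
    (fun x : \bar R => expeR (- maxe 0 ((s`_k)%:E * x))).
  apply: (measurableT_comp measurable_expeR).
  apply: (measurableT_comp (@oppe_measurable R setT)).
  apply: measurable_maxe => //; exact: emeasurable_funM.
have h01 (k : 'I_(size s)) (x : \bar R) :
    0 <= expeR (- maxe 0 ((s`_k)%:E * x)) <= 1.
  rewrite expeR_ge0/= -expeR0 lee_expeR oppe_le0 le_max lexx//.
have maxcN (k : 'I_(size s)) v : maxe 0 ((s`_k)%:E * point_count R X (A k) v) =
    (s`_k)%:E * point_count R X (A k) v by apply/max_idPr.
(* Point counts are nonnegative; the maximum with 0 makes each factor a
   function on the extended line with values in the unit interval. *)
transitivity (\int[Q]_v \prod_(k < size s)
    expeR (- maxe 0 ((s`_k)%:E * point_count R X (A k) v))).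
  apply: eq_integral => v _; rewrite sumE expeRN_sum//.
  by apply: eq_bigr => k _; rewrite maxcN.
rewrite (mutually_independent_integral _ (indep _ A mA tA) mh h01)//; last 2 first.
- by move=> k; exact: measurable_point_count.
- exact: index_enum_uniq.
transitivity (\prod_(k < size s) expeR (- ((1 - expR (- s`_k))%:E * Lam (A k)))).
  apply: eq_bigr => k _; rewrite -laplace_point_count//.
  by apply: eq_integral => v _; rewrite maxcN.
have e0 (k : 'I_(size s)) : (0 <= 1 - expR (- s`_k))%R.
  by rewrite subr_ge0 expR_le1 oppr_le0.
have Lam0 k : 0 <= Lam (A k) by apply: integral_ge0 => e _; rewrite lee_fin.
rewrite -expeRN_sum; last by move=> k; rewrite mule_ge0// lee_fin.
congr (expeR (- _)).
transitivity (\int[nu]_e \sum_(k < size s)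
    (1 - expR (- s`_k))%:E * ((rho e)%:E * (\1_(A k) e)%:E)).
  have mrA (k : 'I_(size s)) : measurable_fun setT (fun e => (rho e)%:E * (\1_(A k) e)%:E).
    by apply: emeasurable_funM; apply/measurable_EFinP => //; exact: measurable_indic.
  rewrite ge0_integral_sum//; last 2 first.
  - by move=> k; exact: emeasurable_funM.
  - by move=> k e _; rewrite !mule_ge0 ?lee_fin.
  apply: eq_bigr => k _; rewrite ge0_integralZl_EFin//; last first.
    by move=> e _; rewrite mule_ge0 ?lee_fin.
  congr (_ * _); rewrite /Lam integral_mkcond; apply: eq_integral => e _.
  by rewrite patchE indicE; case: ifP => _; rewrite ?mule1 ?mule0.
apply: eq_integral => e _.
rewrite (levels (fun y => 1 - expeR (- y%:E))) /= muleC ge0_sume_distrr; last first.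
  by move=> k _; rewrite mule_ge0 ?lee_fin//= -EFinB lee_fin.
by apply: eq_bigr => k _; rewrite muleCA.
Qed.

(** Simple functions increase to [f]; the sums over the points and the integrals
against the intensity both converge monotonically. *)
Lemma laplace_functional (f : E -> \bar R) :
  measurable_fun setT f -> (forall e, 0 <= f e) ->
  \int[Q]_v expeR (- \sum_(0 <= i <oo) f (X i v)) =
  expeR (- \int[nu]_e ((1 - expeR (- f e)) * (rho e)%:E)).
Proof.
move=> mf f0; pose f_ n := nnsfun_approx measurableT mf n.
have ndf e : {homo (fun n => (f_ n e)%:E) : m n / (m <= n)%N >-> m <= n}.
  by move=> m n mn; rewrite lee_fin; exact/lefP/nd_nnsfun_approx.
have cf e : (f_ n e)%:E @[n --> \oo] --> f e.
  by apply: cvg_nnsfun_approx.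
have sum0 v : 0 <= \sum_(0 <= i <oo) f (X i v) by exact: nneseries_ge0.
have lty x : 0 <= x -> - x < +oo :> \bar R.
  by move=> x0; rewrite lteNl (lt_le_trans (ltNyr 0%R)).
have csum v : \sum_(0 <= i <oo) (f_ n (X i v))%:E @[n --> \oo] -->
    \sum_(0 <= i <oo) f (X i v).
  rewrite -ge0_integral_count//.
  have countE n : \sum_(0 <= i <oo) (f_ n (X i v))%:E =
      \int[counting]_i (f_ n (X i v))%:E.
    by rewrite ge0_integral_count// => k; rewrite lee_fin.
  rewrite (eq_fun countE).
  rewrite (_ : \int[counting]_i f (X i v) =
      \int[counting]_i limn (fun n => (f_ n (X i v))%:E)); last first.
    by apply: eq_integral => i _; apply/esym/cvg_lim.
  apply: cvg_monotone_convergence => //.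
  by move=> n i _; rewrite lee_fin.
have msum (g : E -> \bar R) : measurable_fun setT g -> (forall e, 0 <= g e) ->
    measurable_fun setT (fun v => expeR (- \sum_(0 <= i <oo) g (X i v))).
  move=> mg g0; apply: (measurableT_comp measurable_expeR).
  apply: (measurableT_comp (@oppe_measurable R setT)).
  apply: (eq_measurable_fun (fun v => \sum_(0 <= i <oo | i \in xpredT) g (X i v))) => //.
  by apply: ge0_emeasurable_sum => // i _; exact: measurableT_comp.
have c1 : \int[Q]_v expeR (- \sum_(0 <= i <oo) (f_ n (X i v))%:E) @[n --> \oo]
    --> \int[Q]_v expeR (- \sum_(0 <= i <oo) f (X i v)).
  apply: cvg_integral_le1.
  - move=> n; apply: (msum (fun e => (f_ n e)%:E)) => [|e]; last by rewrite lee_fin.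
    exact/measurable_EFinP.
  - exact: msum.
  - move=> n v; rewrite expeR_ge0/= -expeR0 lee_expeR oppe_le0.
    by apply: nneseries_ge0 => i _ _; rewrite lee_fin.
  - by move=> v; apply: cvg_expeR; [exact: lty|exact: cvgeN].
have ge01 x : 0 <= x -> 0 <= 1 - expeR (- x) :> \bar R.
  move=> x0; have x1 : expeR (- x) <= 1 by rewrite -expeR0 lee_expeR oppe_le0.
  by rewrite sube_ge0// ge0_fin_numE ?expeR_ge0// (le_lt_trans x1)// ltry.
have mexp (g : E -> \bar R) : measurable_fun setT g ->
    measurable_fun setT (fun e => 1 - expeR (- g e)).
  move=> mg; apply: emeasurable_funB => //.
  apply: (measurableT_comp measurable_expeR).
  exact: (measurableT_comp (@oppe_measurable R setT)).
have c2 : \int[nu]_e ((1 - expeR (- (f_ n e)%:E)) * (rho e)%:E) @[n --> \oo]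
    --> \int[nu]_e ((1 - expeR (- f e)) * (rho e)%:E).
  rewrite (_ : \int[nu]_e ((1 - expeR (- f e)) * (rho e)%:E) =
     \int[nu]_e limn (fun n => (1 - expeR (- (f_ n e)%:E)) * (rho e)%:E)); last first.
    apply: eq_integral => e _; apply/esym/cvg_lim => //.
    apply: cvgeZr => //; apply: cvgeB;
      [exact: fin_num_adde_defr|exact: cvg_cst|].
    by apply: cvg_expeR; [exact: lty|exact: cvgeN].
  apply: cvg_monotone_convergence => //.
  - move=> n; apply: emeasurable_funM; last exact/measurable_EFinP.
    apply: (mexp (fun e => (f_ n e)%:E)); exact/measurable_EFinP.
  - by move=> n e _; rewrite mule_ge0 ?ge01 ?lee_fin.
  - move=> e _ m n mn; apply: lee_wpmul2r; first by rewrite lee_fin.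
    by apply: leeB => //; rewrite lee_expeR leeN2; exact: ndf.
rewrite (eq_fun (fun n => laplace_nnsfun (f_ n))) in c1.
have c3 : expeR (- \int[nu]_e ((1 - expeR (- (f_ n e)%:E)) * (rho e)%:E))
    @[n --> \oo] --> expeR (- \int[nu]_e ((1 - expeR (- f e)) * (rho e)%:E)).
  apply: cvg_expeR; last exact: cvgeN.
  by apply: lty; apply: integral_ge0 => e _; rewrite mule_ge0 ?ge01 ?lee_fin.
exact: cvg_unique c1 c3.
Qed.

End poisson_laplace.

(** * Marked Poisson processes with all marks below their levels *)

Section marked_poisson.
Context {R : realType} (dV : measure_display) (V : measurableType dV).
Context (Q : probability V R) (dE : measure_display) (E : measurableType dE).
Context (nu : {measure set E -> \bar R}) (rho : E -> R).
Context (M : Type) (F : set (set M)).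
Context (X : nat -> V -> E) (Y : nat -> V -> M).
Context (kap : E -> set M -> \bar R) (C : R -> set M) (r : E -> R).

(** If marks are attached independently to the points of a Poisson process, the
mark of a point [e] having law [kap e], the points whose mark is not in
[C (r e)] form a thinned Poisson process; the right-hand side is the
probability that it has no point. *)
Lemma marked_poisson_void :
  (forall e, (0 <= rho e)%R) -> measurable_fun setT rho ->
  poisson_process Q X (fun A => \int[nu]_(e in A) (rho e)%:E) ->
  (forall i A, F A -> measurable (Y i @^-1` A)) ->
  (forall e A, F A -> 0 <= kap e A <= 1) ->
  (forall A, F A -> measurable_fun setT (kap ^~ A)) ->
  (forall (n : nat) (A : 'I_n -> set M) (G : set V),
    (forall i, F (A i)) -> sigma_of X G ->
    Q (G `&` \bigcap_(i in [set: 'I_n]) (Y i @^-1` A i)) =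
    \int[Q]_(v in G) \prod_(i < n) kap (X i v) (A i)) ->
  (forall p, F (C p)) -> measurable_fun setT r ->
  (forall (q : nat -> R) p f, (forall m, q m <= p)%R ->
    q m @[m --> \oo] --> p -> \forall m \near \oo, C (q m) f <-> C p f) ->
  (forall (q : nat -> R) p e, (forall m, q m <= p)%R ->
    q m @[m --> \oo] --> p -> kap e (C (q m)) @[m --> \oo] --> kap e (C p)) ->
  Q [set v | forall i, C (r (X i v)) (Y i v)] =
  expeR (- \int[nu]_e ((1 - kap e (C (r e))) * (rho e)%:E)).
Proof.
move=> rho0 mrho ppX mY kap01 mkap marksE FC mr nearC cvgC.
have mX i : measurable_fun setT (X i) by case: ppX.
rewrite (marks_below_all mX mY kap01 mkap marksE FC mr nearC cvgC).
rewrite (laplace_functional rho0 mrho ppX (f := fun e => - lne (kap e (C (r e))))).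
- congr (expeR (- _)); apply: eq_integral => e _.
  rewrite oppeK lneK// in_itv/= leey andbT.
  by case/andP: (kap01 e _ (FC (r e))).
- apply: (measurableT_comp (@oppe_measurable R setT)).
  apply: (measurableT_comp measurable_lne).
  exact: (measurable_kap_threshold mkap FC mr cvgC).
- by move=> e; rewrite oppe_ge0 lne_le0; case/andP: (kap01 e _ (FC (r e))).
Qed.

End marked_poisson.

(** * Paths below finitely many levels *)

Section levels.
Context {R : realType} (T : Type) (n : nat).
Variables (t : 'I_n -> T) (x : 'I_n -> \bar R).

Definition below_levels (p : R) : set (T -> \bar R) :=
  [set f | forall j, p%:E + f (t j) <= x j].

(** A violated inequality is strict, hence still violated at nearby points; a
satisfied one remains so at lower points, and [q] approaches [p] from below. *)
Lemma near_below_levels (q : nat -> R) p f : (forall m, q m <= p)%R ->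
  q m @[m --> \oo] --> p ->
  \forall m \near \oo, below_levels (q m) f <-> below_levels p f.
Proof.
move=> qp cq; have [fp|nfp] := pselect (below_levels p f).
  apply: nearW => m; split => // _ j; apply: le_trans (fp j).
  by rewrite leeD2r// lee_fin.
have [j /negP] : exists j, ~ (p%:E + f (t j) <= x j).
  exact/existsNP.
rewrite -ltNge => xpf.
suff : \forall m \near \oo, x j < (q m)%:E + f (t j).
  apply: filterS => m xqf; split => [|/nfp]//.
  by move=> /(_ j); rewrite leNgt xqf.
have : (fun m => (q m)%:E + f (t j)) @ \oo --> p%:E + f (t j).
  apply: cvgeD; [exact: fin_num_adde_defr| |exact: cvg_cst].
  by apply: cvg_EFin => //; exact: nearW.
move=> /(_ [set y | x j < y]); apply.
apply: open_nbhs_nbhs; split => //; exact: open_ereal_gt_ereal.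
Qed.

Lemma path_sigma_eval_set s (B : set (\bar R)) : measurable B ->
  path_sigma (R := R) [set f : T -> \bar R | B (f s)].
Proof. by move=> mB; apply: sub_sigma_algebra; exists s, B. Qed.

Lemma measurable_shift_le (p : R) (y : \bar R) :
  measurable [set z : \bar R | p%:E + z <= y].
Proof.
rewrite -[X in measurable X]setTI.
by apply: emeasurable_fun_infty_c => //; exact: emeasurable_funD.
Qed.

Lemma path_sigma_below_levels p : path_sigma (below_levels p).
Proof.
have -> : below_levels p = \bigcap_(j in [set: 'I_n])
    [set f | [set z : \bar R | p%:E + z <= x j] (f (t j))].
  by apply/seteqP; split => f /= h j; [move=> _; exact: h|exact: h].
apply: (@fin_bigcap_measurable _ (g_sigma_algebraType _)) => // j _.
exact: path_sigma_eval_set (measurable_shift_le _ _).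
Qed.

End levels.

Section measurable_paths.
Context {R : realType} (T : Type).

Lemma sigma_of_path (d : measure_display) (W : measurableType d)
    (Y : T -> W -> \bar R) A :
  path_sigma A -> sigma_of Y (path_of Y @^-1` A).
Proof.
move=> sA; apply: (sA (fun A => sigma_of Y (path_of Y @^-1` A))).
split; first split.
- by rewrite preimage_set0; exact: sigma_algebra0.
- move=> B sB; rewrite setTD -preimage_setC.
  exact: (sigma_algebraC sB).
- by move=> B sB; rewrite preimage_bigcup;
    exact: (sigma_algebra_bigcup sB).
- move=> _ [t [B [mB ->]]]; apply: sub_sigma_algebra.
  by exists t, B.
Qed.

Lemma measurable_path (d : measure_display) (W : measurableType d)
    (Y : T -> W -> \bar R) A :
  (forall t, measurable_fun setT (Y t)) ->
  path_sigma A -> measurable (path_of Y @^-1` A).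
Proof.
by move=> mY sA; exact: sigma_of_measurable mY (sigma_of_path sA).
Qed.

End measurable_paths.

(** * The Gumbel intensity and exponential tilting *)

Section translation.
Context {R : realType}.
Local Notation leb := (@lebesgue_measure R).

Lemma lebesgue_measure_shift (s : R) (A : set R) : measurable A ->
  pushforward leb ((fun p => p - s)%R : _ -> measurableTypeR R) A = leb A.
Proof.
move=> mA; apply/esym/lebesgue_measure_unique => //=.
  by apply: measurable_funB.
move=> _ _ [[a b]] _ <-.
rewrite /pushforward /=.
rewrite (_ : _ @^-1` _ = `](a + s)%R, (b + s)%R]%classic); last first.
  by apply/seteqP; split => p /=; rewrite !in_itv/= ltrBrDr lerBlDr.
rewrite !lebesgue_measure_itv/= !lte_fin ltrD2r.
by case: ifP => // _; rewrite -!EFinB opprD addrACA subrr addr0.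
Qed.

Lemma ge0_integral_shift (s : R) (h : R -> \bar R) :
  measurable_fun setT h -> (forall p, 0 <= h p) ->
  \int[leb]_p h (p - s)%R = \int[leb]_p h p.
Proof.
move=> mh h0.
pose phi := (fun p => p - s)%R : R -> measurableTypeR R.
have mphi : measurable_fun setT phi by exact: measurable_funB.
transitivity (\int[leb]_(p in phi @^-1` setT) (h \o phi) p) => //.
rewrite -ge0_integral_pushforward//.
apply: eq_measure_integral => //= A mA _; exact: lebesgue_measure_shift.
Qed.

(** The max-stability of the Gumbel intensity: a translation multiplies it by a
constant. *)
Lemma gumbel_integral_shift (s : R) (g : R -> \bar R) :
  measurable_fun setT g -> (forall p, 0 <= g p) ->
  \int[leb]_p (g (p - s)%R * (expR (- p))%:E) =
  (expR (- s))%:E * \int[leb]_p (g p * (expR (- p))%:E).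
Proof.
move=> mg g0.
have mexp : measurable_fun setT (fun p : R => (expR (- p))%:E).
  by apply/measurable_EFinP; exact: measurableT_comp.
have mge : measurable_fun setT (fun p => g p * (expR (- p))%:E).
  exact: emeasurable_funM.
have ge0 p : 0 <= g p * (expR (- p))%:E by rewrite mule_ge0// lee_fin expR_ge0.
rewrite -ge0_integralZl_EFin ?expR_ge0//.
rewrite -(@ge0_integral_shift s
  (fun p => (expR (- s))%:E * (g p * (expR (- p))%:E))); last 2 first.
- exact: emeasurable_funM.
- by move=> p; rewrite mule_ge0// lee_fin expR_ge0.
apply: eq_integral => p _; rewrite muleCA -EFinM -expRD.
by rewrite opprB addrA addNr add0r.
Qed.

End translation.

Section tilting.
Context {R : realType} (dT : measure_display) (T : measurableType dT).
Context (dW : measure_display) (W : measurableType dW) (P : probability W R).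
Variable Z : {mfun (T * W)%type >-> \bar R}.
Hypothesis Z_lty : forall t w, Z (t, w) < +oo.
Hypothesis EexpZ : forall t, \int[P]_w expeR (Z (t, w)) = 1.

Lemma measurable_Z h : measurable_fun setT (fun w => Z (h, w)).
Proof. exact: measurableT_comp. Qed.

Lemma measurable_expZ h : measurable_fun setT (fun w => expeR (Z (h, w))).
Proof. exact: (measurableT_comp measurable_expeR (measurable_Z h)). Qed.

(** The integrand vanishes where [Z h = -oo]. *)
Lemma integral_exceed_bot h A : measurable A ->
  \int[P]_(w in A `&` exceed_bot Z h) expeR (Z (h, w)) =
  \int[P]_(w in A) expeR (Z (h, w)).
Proof.
move=> mA; rewrite integral_mkcondr; apply: eq_integral => w _.
rewrite patchE; case: ifPn => // /negP; rewrite inE /exceed_bot /=.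
by move=> /negP; rewrite -leNgt leeNy_eq => /eqP ->.
Qed.

Lemma exceed_bot_gt0 h : 0 < P (exceed_bot Z h).
Proof.
rewrite lt_neqAle measure_ge0 andbT; apply/eqP => P0.
have /eqP := EexpZ h; rewrite -integral_exceed_bot// setTI.
rewrite (_ : \int[P]_(w in _) _ = 0) ?lt_eqF ?lte01//.
rewrite -[RHS](@integral_abs_eq0 _ _ _ P (exceed_bot Z h) (fun w => expeR (Z (h, w))))//.
- by apply: eq_integral => w _; rewrite gee0_abs// expeR_ge0.
- exact: measurable_exceed_bot.
- exact: measurable_funTS (measurable_expZ h).
Qed.

Let pr h := fine (P (exceed_bot Z h)).

Lemma integral_cond_prob h A (f : W -> \bar R) :
  measurable A -> measurable_fun A f -> (forall w, A w -> 0 <= f w) ->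
  \int[cond_prob P Z h]_(w in A) f w =
  (pr h)^-1%:E * \int[P]_(w in A `&` exceed_bot Z h) f w.
Proof.
move=> mA mf f0; have P0 := exceed_bot_gt0 h.
have mE := measurable_exceed_bot Z h.
have pr0 : (0 <= (pr h)^-1)%R by rewrite invr_ge0 fine_ge0.
have condE B : cond_prob P Z h B = P (B `&` exceed_bot Z h) * (pr h)^-1%:E.
  have PE : P (setT `&` exceed_bot Z h) = P (exceed_bot Z h) by rewrite setTI.
  rewrite /cond_prob /= /mnormalize; case: ifPn => [/orP[/eqP|/eqP]|_].
  - by rewrite -[LHS]/(P (setT `&` exceed_bot Z h)) PE => PE0; rewrite PE0 ltxx in P0.
  - rewrite -[LHS]/(P (setT `&` exceed_bot Z h)) PE => PEy.
    by have := probability_le1 P mE; rewrite PEy.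
  - by rewrite /pr -PE.
rewrite (ge0_negligible_integral (N := ~` exceed_bot Z h))//; last 2 first.
- exact: measurableC.
- by rewrite [LHS]condE setICl measure0 mul0e.
rewrite setDE setCK.
have mAE : measurable (A `&` exceed_bot Z h) by exact: measurableI.
rewrite -(@ge0_integral_mscale _ _ _ P _ mAE (NngNum pr0) f)//; last 2 first.
- exact: measurable_funS mf.
- by move=> w [/f0].
apply: eq_measure_integral => B mB BA.
by rewrite [LHS]condE /mscale/= muleC setIidl// => w /BA[].
Qed.

(** The normalisation of the conditional law given [Z h > -oo] cancels against
that of the tilting, and the density vanishes where [Z h = -oo]. *)
Lemma tilted_density h A : measurable A ->
  tilted P Z h A = \int[P]_(w in A) expeR (Z (h, w)).
Proof.
move=> mA; have P0 := exceed_bot_gt0 h.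
have pr0 : (0 < pr h)%R.
  rewrite fine_gt0// P0 (le_lt_trans (probability_le1 _ _)) ?ltry//.
  exact: measurable_exceed_bot.
have mexp B : measurable_fun B (fun w => expeR (Z (h, w))).
  exact: measurable_funTS (measurable_expZ h).
rewrite /tilted.
have -> : \int[cond_prob P Z h]_v expeR (Z (h, v)) = (pr h)^-1%:E.
  rewrite integral_cond_prob//; last by move=> w _; exact: expeR_ge0.
  by rewrite integral_exceed_bot// EexpZ mule1.
have expE w : expeR (Z (h, w) - lne (pr h)^-1%:E) = (pr h)%:E * expeR (Z (h, w)).
  rewrite lneV// oppeK expeRD muleC; congr (_ * _).
  by rewrite lneK// in_itv/= leey andbT lee_fin ltW.
under eq_integral do rewrite expE.
rewrite integral_cond_prob//; last 2 first.
- exact: emeasurable_funM.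
- by move=> w _; rewrite mule_ge0 ?expeR_ge0// lee_fin ltW.
rewrite ge0_integralZl_EFin//; last 3 first.
- by apply: measurableI => //; exact: measurable_exceed_bot.
- by move=> w _; exact: expeR_ge0.
- exact: ltW.
by rewrite integral_exceed_bot// muleA -EFinM mulVf ?gt_eqF// mul1e.
Qed.

End tilting.

(** * Excess mass of a path *)

Section excess.
Context {R : realType} (dT : measure_display) (T : measurableType dT) (n : nat).
Variables (t : 'I_n -> T) (x : 'I_n -> \bar R).
Local Notation leb := (@lebesgue_measure R).
Local Notation below := (below_levels t x).

Lemma measurable_below (d : measure_display) (U : measurableType d)
    (r : U -> R) (phi : U -> T -> \bar R) :
  measurable_fun setT r -> (forall s, measurable_fun setT (phi ^~ s)) ->
  measurable [set u | below (r u) (phi u)].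
Proof.
move=> mr mphi; rewrite (_ : [set u | _] =
  \bigcap_(j in [set: 'I_n]) [set u | (r u)%:E + phi u (t j) <= x j]); last first.
  by apply/seteqP; split => u /= h j; [move=> _; exact: h|exact: h].
apply: fin_bigcap_measurable => // j _.
rewrite -[X in measurable X]setTI; apply: emeasurable_fun_infty_c => //.
by apply: emeasurable_funD => //; exact/measurable_EFinP.
Qed.

Definition excess (p : R) (f : T -> \bar R) : \bar R :=
  (\1_[set g : T -> \bar R | ~ below p g] f)%:E.

Lemma excess_ge0 p f : 0 <= excess p f. Proof. by rewrite lee_fin. Qed.

Lemma measurable_excess (d : measure_display) (U : measurableType d)
    (r : U -> R) (phi : U -> T -> \bar R) :
  measurable_fun setT r -> (forall s, measurable_fun setT (phi ^~ s)) ->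
  measurable_fun setT (fun u => excess (r u) (phi u)).
Proof.
move=> mr mphi; apply/measurable_EFinP.
rewrite (_ : (fun u => _) = \1_(~` [set u | below (r u) (phi u)]))//.
by apply: measurable_indic; apply: measurableC; exact: measurable_below.
Qed.

Definition excess_mass (f : T -> \bar R) : \bar R :=
  \int[leb]_p (excess p f * (expR (- p))%:E).

Lemma excess_mass_ge0 f : 0 <= excess_mass f.
Proof.
by apply: integral_ge0 => p _; rewrite mule_ge0 ?excess_ge0// lee_fin expR_ge0.
Qed.

(** Lowering the path by [s] is the same as lowering the point [p] by [s]. *)
Lemma excess_mass_shift (s : R) (f : T -> \bar R) :
  excess_mass (fun u => f u - s%:E) = (expR (- s))%:E * excess_mass f.
Proof.
rewrite /excess_mass -(gumbel_integral_shift s (g := excess ^~ f)).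
- apply: eq_integral => p _; congr (_ * _); rewrite /excess !indicE.
  congr (_%:R%:E); congr nat_of_bool.
  apply/idP/idP; rewrite !inE /= => h b; apply: h => j.
    by have := b j; rewrite EFinB addeAC addeA.
  by have := b j; rewrite EFinB addeAC addeA.
- exact: (@measurable_excess _ R id (fun=> f)).
- by move=> p; exact: excess_ge0.
Qed.

Lemma excess_massNy (f : T -> \bar R) : (forall s, f s = -oo) -> excess_mass f = 0.
Proof.
move=> fNy; rewrite /excess_mass -[RHS](@integral0 _ _ _ leb setT).
apply: eq_integral => p _; rewrite /excess indicE memNset ?mul0e//= => nb.
by apply: nb => j; rewrite fNy addeNy leNye.
Qed.

Lemma measurable_excess_mass (d : measure_display) (U : measurableType d)
    (phi : U -> T -> \bar R) :
  (forall s, measurable_fun setT (phi ^~ s)) ->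
  measurable_fun setT (fun u => excess_mass (phi u)).
Proof.
move=> mphi; apply: (measurable_fun_fubini_tonelli_F (m2 := leb)
   (fun up : U * R => excess up.2 (phi up.1) * (expR (- up.2))%:E)).
- apply: emeasurable_funM.
    apply: measurable_excess => // s.
    exact: (measurableT_comp (f := phi ^~ s)).
  apply/measurable_EFinP; apply: measurableT_comp => //.
  exact: measurableT_comp.
- by move=> up; rewrite mule_ge0 ?excess_ge0// lee_fin expR_ge0.
Qed.

End excess.

Section exponents.
Context {R : realType} (dT : measure_display) (T : measurableType dT) (n : nat).
Variables (t : 'I_n -> T) (x : 'I_n -> \bar R).
Local Notation leb := (@lebesgue_measure R).
Context (dW : measure_display) (W : measurableType dW) (P : probability W R).

(** Tonelli, integrating first over the points [p] on the left and first over
[W] on the right. *)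
Lemma integral_excess_mass (mu : {sigma_finite_measure set W -> \bar R})
    (c : W -> \bar R) (phi : W -> T -> \bar R) :
  measurable_fun setT c -> (forall w, 0 <= c w) ->
  (forall s, measurable_fun setT (phi ^~ s)) ->
  \int[mu]_w (c w * excess_mass t x (phi w)) =
  \int[leb]_p (\int[mu]_(w in [set w | ~ below_levels t x p (phi w)]) c w *
               (expR (- p))%:E).
Proof.
move=> mc c0 mphi.
have mexc : measurable_fun setT (fun pw : R * W => excess t x pw.1 (phi pw.2)).
  apply: measurable_excess => // s.
  exact: (measurableT_comp (f := phi ^~ s)).
have mexcp p : measurable_fun setT (fun w => excess t x p (phi w)).
  exact: measurable_excess.
have e0 (p : R) : 0 <= (expR (- p))%:E by rewrite lee_fin expR_ge0.
have cexc0 p w : 0 <= c w * excess t x p (phi w).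
  by rewrite mule_ge0 ?excess_ge0.
transitivity (\int[mu]_w \int[leb]_p
    (c w * excess t x p (phi w) * (expR (- p))%:E)).
  apply: eq_integral => w _; rewrite -ge0_integralZl//.
  - by apply: eq_integral => p _; rewrite muleA.
  - apply: emeasurable_funM.
      exact: (@measurable_excess _ _ _ _ _ _ _ R id (fun=> phi w)).
    by apply/measurable_EFinP; exact: measurableT_comp.
  - by move=> p _; rewrite mule_ge0 ?excess_ge0.
rewrite -(fubini_tonelli (m1 := leb) (m2 := mu)
  (fun pw : R * W => c pw.2 * excess t x pw.1 (phi pw.2) * (expR (- pw.1))%:E))/=; last 2 first.
- apply: emeasurable_funM; first apply: emeasurable_funM => //.
    exact: (measurableT_comp (f := c)).
  apply/measurable_EFinP; apply: measurableT_comp => //; exact: measurableT_comp.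
- by move=> pw; rewrite mule_ge0.
apply: eq_integral => p _; rewrite ge0_integralZr//; last exact: emeasurable_funM.
congr (_ * _); rewrite [RHS]integral_mkcond; apply: eq_integral => w _.
rewrite /excess indicE patchE.
have -> : (phi w \in [set g | ~ below_levels t x p g]) =
    (w \in [set w | ~ below_levels t x p (phi w)]) by apply/idP/idP; rewrite !inE.
by case: ifP; rewrite ?mule1 ?mule0.
Qed.

End exponents.

(** * The law of the shape function *)

Section shape_law.
Context {R : realType} (dT : measure_display) (T : measurableType dT).
Context (dW : measure_display) (W : measurableType dW) (P : probability W R).
Variable Z : {mfun (T * W)%type >-> \bar R}.
Variable mu : {sigma_finite_measure set T -> \bar R}.
Local Notation leb := (@lebesgue_measure R).
Local Notation sh := (Defs.shape Z mu).

Hypothesis Z_lty : forall t w, Z (t, w) < +oo.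
Hypothesis EexpZ : forall t, \int[P]_w expeR (Z (t, w)) = 1.

(** Measurability jointly in the location and the outcome, which Tonelli
requires, comes from the joint measurability of [Z]. *)
Lemma measurable_shape2 s : measurable_fun setT (fun hw : T * W => sh s hw.1 hw.2).
Proof.
have mZ2 (d : measure_display) (U : measurableType d) (f : U -> T) (g : U -> W) :
    measurable_fun setT f -> measurable_fun setT g ->
    measurable_fun setT (fun u => Z (f u, g u)).
  move=> mf mg; apply: (measurableT_comp (f := Z)) => //.
  exact: measurable_fun_pair.
apply: emeasurable_funB; first by apply: emeasurable_funB; exact: mZ2.
apply: (measurableT_comp measurable_lne).
apply: (measurable_fun_fubini_tonelli_F (m2 := mu)
  (fun hws : (T * W) * T => expeR (Theta Z hws.1.1 hws.2 hws.1.2))).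
- apply: (measurableT_comp measurable_expeR).
  have m11 : measurable_fun setT (fun hws : (T * W) * T => hws.1.1).
    exact: measurableT_comp.
  have m12 : measurable_fun setT (fun hws : (T * W) * T => hws.1.2).
    exact: measurableT_comp.
  by apply: emeasurable_funB; exact: mZ2.
- by move=> hws; exact: expeR_ge0.
Qed.

Lemma measurable_shape s h : measurable_fun setT (sh s h).
Proof. exact: (measurableT_comp (measurable_shape2 s) (pair1_measurable h)). Qed.

Lemma measurable_expZ2 : measurable_fun setT (fun hw : T * W => expeR (Z hw)).
Proof. exact: (measurableT_comp measurable_expeR). Qed.

(** The value [Z h] is subtracted both in [Theta] and, as a factor
[exp (- Z h)] in the integral, in its logarithm; the two cancel as soon as
[Z h] is finite. *)
Lemma shape_int_exp s h w : -oo < Z (h, w) ->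
  0 < int_exp Z mu w -> int_exp Z mu w < +oo ->
  sh s h w = Z (s, w) - (ln (fine (int_exp Z mu w)))%:E.
Proof.
move=> Zh S0 Sy.
have [z Zz] : exists z, Z (h, w) = z%:E.
  by move: Zh (Z_lty h w); case: (Z (h, w)) => [z||]// _ _; exists z.
have [r r0 Sr] : exists2 r, (0 < r)%R & int_exp Z mu w = r%:E.
  by move: S0 Sy; case: (int_exp Z mu w) => [r||]//; rewrite lte_fin; exists r.
rewrite /Defs.shape /Theta Zz Sr /=.
rewrite (_ : \int[mu]_s0 _ = (expR (- z) * r)%:E); last first.
  under eq_integral do rewrite expeRD /= muleC.
  rewrite ge0_integralZl_EFin ?expR_ge0//; last 2 first.
  - by move=> u _; exact: expeR_ge0.
  - apply: (measurableT_comp measurable_expeR).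
    exact: measurableT_comp.
  by rewrite EFinM -Sr.
rewrite lne_EFin ?mulr_gt0 ?expR_gt0// lnM ?posrE ?expR_gt0// expRK.
case: (Z (s, w)) => [a||]//=.
by rewrite -!EFinB opprD opprK addrA subrK.
Qed.

Lemma shape_lawE h A : path_sigma A ->
  shape_law P Z mu h A = \int[P]_(w in path_of (sh ^~ h) @^-1` A) expeR (Z (h, w)).
Proof.
move=> sA; rewrite /shape_law tilted_density//.
by apply: measurable_path => // s; exact: measurable_shape.
Qed.

Lemma shape_law_setC h A : path_sigma A ->
  1 - shape_law P Z mu h A =
  \int[P]_(w in ~` (path_of (sh ^~ h) @^-1` A)) expeR (Z (h, w)).
Proof.
move=> sA.
have mA : measurable (path_of (sh ^~ h) @^-1` A).
  by apply: measurable_path => // s; exact: measurable_shape.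
have mexp B : measurable_fun B (fun w => expeR (Z (h, w))).
  exact: measurable_funTS (measurable_expZ Z h).
rewrite shape_lawE// -(EexpZ h).
rewrite -[X in \int[P]_(w in X) _](setvU (path_of (sh ^~ h) @^-1` A)).
rewrite ge0_integral_setU//.
- rewrite addeK// ge0_fin_numE; last by apply: integral_ge0 => w _; exact: expeR_ge0.
  apply: (@le_lt_trans _ _ (\int[P]_w expeR (Z (h, w)))); last by rewrite EexpZ ltry.
  by apply: ge0_subset_integral => // w _; exact: expeR_ge0.
- exact: measurableC.
- by move=> w _; exact: expeR_ge0.
- by rewrite disj_set2E setICl.
Qed.

Lemma shape_law_ge0_le1 h A : path_sigma A -> 0 <= shape_law P Z mu h A <= 1.
Proof.
move=> sA; apply/andP; split.
  by rewrite shape_lawE//; apply: integral_ge0 => w _; exact: expeR_ge0.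
rewrite shape_lawE// -(EexpZ h); apply: ge0_subset_integral => //.
- by apply: measurable_path => // s; exact: measurable_shape.
- exact: measurable_expZ.
- by move=> w _; exact: expeR_ge0.
Qed.

Lemma measurable_shape_law A : path_sigma A ->
  measurable_fun setT (fun h => shape_law P Z mu h A).
Proof.
move=> sA.
have mA : measurable (path_of (fun s (hw : T * W) => sh s hw.1 hw.2) @^-1` A).
  by apply: measurable_path => // s; exact: measurable_shape2.
rewrite (_ : (fun h => _) = fubini_F P (fun hw : T * W => expeR (Z hw) *
    (\1_(path_of (fun s (hw : T * W) => sh s hw.1 hw.2) @^-1` A) hw)%:E)).
  apply: measurable_fun_fubini_tonelli_F.
  - apply: emeasurable_funM; first exact: measurable_expZ2.
    by apply/measurable_EFinP; exact: measurable_indic.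
  - by move=> hw; rewrite mule_ge0 ?expeR_ge0// lee_fin.
apply/funext => h; transitivity (\int[P]_w (expeR (Z (h, w)) *
    (\1_(path_of (fun s (hw : T * W) => sh s hw.1 hw.2) @^-1` A) (h, w))%:E)) => //.
rewrite shape_lawE// integral_mkcond.
apply: eq_integral => w _; rewrite patchE indicE.
rewrite (_ : ((h, w) \in _) = (w \in path_of (sh ^~ h) @^-1` A)).
  by case: ifP; rewrite ?mule1 ?mule0.
by apply/idP/idP; rewrite !inE.
Qed.

End shape_law.

Lemma cvg_integral_near_set {R : realType} (d : measure_display)
    (W : measurableType d) (P : {measure set W -> \bar R})
    (c : W -> \bar R) (D_ : nat -> set W) (D : set W) :
  measurable_fun setT c -> (forall w, 0 <= c w) -> \int[P]_w c w < +oo ->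
  (forall m, measurable (D_ m)) -> measurable D ->
  (forall w, \forall m \near \oo, D_ m w <-> D w) ->
  \int[P]_(w in D_ m) c w @[m --> \oo] --> \int[P]_(w in D) c w.
Proof.
move=> mc c0 cy mD_ mD nearD.
rewrite integral_mkcond; under eq_fun do rewrite integral_mkcond.
have [] := @dominated_convergence _ _ _ P setT measurableT
  (fun m => c \_ (D_ m)) (c \_ D) c.
- by move=> m; apply/(measurable_restrictT _ (mD_ m)).1; exact: measurable_funTS.
- by apply/(measurable_restrictT _ mD).1; exact: measurable_funTS.
- apply: aeW => w _; apply: cvg_near_cst; apply: filterS (nearD w) => m h.
  rewrite !patchE (_ : (w \in D_ m) = (w \in D))//.
  by apply/idP/idP; rewrite !inE => /h.
- by apply/integrableP; split => //; under eq_integral do rewrite gee0_abs//.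
- apply: aeW => w m _; rewrite patchE; case: ifP => _; first by rewrite gee0_abs.
  by rewrite abse0.
- done.
Qed.

(** * Equality of the two exponents *)

Section intensities.
Context {R : realType} (dT : measure_display) (T : measurableType dT).
Context (dW : measure_display) (W : measurableType dW) (P : probability W R).
Variable Z : {mfun (T * W)%type >-> \bar R}.
Variable mu : {sigma_finite_measure set T -> \bar R}.
Context (n : nat) (t : 'I_n -> T) (x : 'I_n -> \bar R).
Local Notation leb := (@lebesgue_measure R).
Local Notation sh := (Defs.shape Z mu).
Local Notation below := (below_levels t x).
Local Notation Zp := (fun s w => Z (s, w)).

Lemma spectral_exponent :
  \int[leb]_p ((1 - P (path_of Zp @^-1` below p)) * (expR (- p))%:E) =
  \int[P]_w excess_mass t x (path_of Zp w).
Proof.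
have mZ s : measurable_fun setT (Zp s) by exact: measurable_Z.
transitivity (\int[P]_w (cst 1 w * excess_mass t x (path_of Zp w))); last first.
  by apply: eq_integral => w _; rewrite mul1e.
rewrite integral_excess_mass//.
apply: eq_integral => p _; congr (_ * _).
have mb : measurable (path_of Zp @^-1` below p).
  by apply: measurable_path => //; exact: path_sigma_below_levels.
by rewrite -probability_setC// integral_cst ?mul1e//; exact: measurableC.
Qed.

Hypothesis Z_lty : forall t w, Z (t, w) < +oo.
Hypothesis EexpZ : forall t, \int[P]_w expeR (Z (t, w)) = 1.
Hypothesis S_meas : measurable_fun setT (int_exp Z mu).
Hypothesis S_fin : {ae P, forall w, int_exp Z mu w < +oo}.
Hypothesis MS0 : P [set w | 0 < sup_exp Z w /\ int_exp Z mu w = 0] = 0.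
Hypothesis M_meas : measurable_fun setT (sup_exp Z).

(** With [S] positive and finite, the shape function at [h] is [Z - ln S], of
excess mass [J Z / S], and the weights [exp (Z h)] integrate to [S].  With
[S = 0] the path [Z] is identically [-oo] and both sides vanish. *)
Lemma integral_shape_excess_mass w :
  int_exp Z mu w < +oo -> ~ (0 < sup_exp Z w /\ int_exp Z mu w = 0) ->
  \int[mu]_h (expeR (Z (h, w)) * excess_mass t x (path_of (sh ^~ h) w)) =
  excess_mass t x (path_of Zp w).
Proof.
move=> Sy nMS.
have S_ge0 : 0 <= int_exp Z mu w by apply: integral_ge0 => h _; exact: expeR_ge0.
have [S0|S0] := eqVneq (int_exp Z mu w) 0.
  have ZNy s : Z (s, w) = -oo.
    apply: contra_notP nMS => /eqP Zs; split => //.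
    apply: (@lt_le_trans _ _ (expeR (Z (s, w)))).
      by rewrite expeR_gt0// ltNye.
    by apply: ereal_sup_ubound; exists s.
  rewrite (excess_massNy t x (f := path_of Zp w) ZNy).
  rewrite -[RHS](@integral0 _ _ _ mu setT); apply: eq_integral => h _.
  by rewrite ZNy mul0e.
have S_gt0 : 0 < int_exp Z mu w by rewrite lt_neqAle eq_sym S0.
pose c := (ln (fine (int_exp Z mu w)))%R.
have Sc : int_exp Z mu w = (expR c)%:E.
  by rewrite /c lnK ?posrE ?fine_gt0 ?S_gt0// fineK// ge0_fin_numE.
transitivity (\int[mu]_h (expeR (Z (h, w)) *
    ((expR (- c))%:E * excess_mass t x (path_of Zp w)))).
  apply: eq_integral => h _.
  have [->|Zh] := eqVneq (Z (h, w)) -oo; first by rewrite !mul0e.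
  congr (_ * _); rewrite -excess_mass_shift; congr (excess_mass _ _ _).
  by apply/funext => s; rewrite /path_of shape_int_exp// ltNye.
rewrite ge0_integralZr//.
- by rewrite -[X in X * _]/(int_exp Z mu w) Sc muleA -EFinM -expRD subrr expR0 mul1e.
- apply: (measurableT_comp measurable_expeR).
  exact: measurableT_comp.
- by move=> h _; exact: expeR_ge0.
- by rewrite mule_ge0 ?excess_mass_ge0// lee_fin expR_ge0.
Qed.

Lemma shape_exponent :
  \int[leb \x mu]_e ((1 - shape_law P Z mu e.2 (below e.1)) * (expR (- e.1))%:E) =
  \int[P]_w excess_mass t x (path_of Zp w).
Proof.
have msh s := measurable_shape2 Z mu s.
have sb p : path_sigma (below p) := path_sigma_below_levels t x p.
pose D p h := [set w | ~ below p (path_of (sh ^~ h) w)].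
have lawE p h : 1 - shape_law P Z mu h (below p) =
    \int[P]_(w in D p h) expeR (Z (h, w)).
  by rewrite shape_law_setC.
have mlaw : measurable_fun setT (fun e : R * T =>
    (1 - shape_law P Z mu e.2 (below e.1)) * (expR (- e.1))%:E).
  apply: emeasurable_funM; last first.
    by apply/measurable_EFinP; apply: measurableT_comp => //; exact: measurableT_comp.
  rewrite (_ : (fun e => _) = fubini_F P (fun ew : (R * T) * W =>
      expeR (Z (ew.1.2, ew.2)) *
      excess t x ew.1.1 (path_of (sh ^~ ew.1.2) ew.2))).
    apply: measurable_fun_fubini_tonelli_F.
    - have m12 : measurable_fun setT (fun ew : (R * T) * W => ew.1.2).
        exact: measurableT_comp.
      have m122 : measurable_fun setT (fun ew : (R * T) * W => (ew.1.2, ew.2)).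
        exact: measurable_fun_pair.
      apply: emeasurable_funM.
        exact: (measurableT_comp (measurable_expZ2 Z) m122).
      apply: measurable_excess; first exact: measurableT_comp.
      by move=> s; exact: (measurableT_comp (msh s) m122).
    - by move=> ew; rewrite mule_ge0 ?expeR_ge0 ?excess_ge0.
  apply/funext => -[p h]; transitivity (\int[P]_w (expeR (Z (h, w)) *
      excess t x p (path_of (sh ^~ h) w))) => //=.
  rewrite lawE integral_mkcond; apply: eq_integral => w _.
  rewrite patchE /excess indicE.
  have -> : (path_of (sh ^~ h) w \in [set g | ~ below p g]) = (w \in D p h).
    by apply/idP/idP; rewrite !inE.
  by case: ifP; rewrite ?mule1 ?mule0.
rewrite fubini_tonelli2//; last first.
  move=> e; rewrite mule_ge0 ?lee_fin ?expR_ge0//.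
  by rewrite lawE; apply: integral_ge0 => w _; exact: expeR_ge0.
pose K (hw : T * W) := expeR (Z hw) * excess_mass t x (path_of (sh ^~ hw.1) hw.2).
have K0 hw : 0 <= K hw by rewrite mule_ge0 ?expeR_ge0 ?excess_mass_ge0.
have mK : measurable_fun setT K.
  apply: emeasurable_funM; first exact: measurable_expZ2.
  exact: measurable_excess_mass.
transitivity (\int[mu]_h \int[P]_w K (h, w)).
  apply: eq_integral => h _; rewrite /K/= integral_excess_mass//.
  - by rewrite /fubini_G; apply: eq_integral => p _ /=; rewrite lawE.
  - exact: measurable_expZ.
  - by move=> w; exact: expeR_ge0.
  - by move=> s; exact: measurable_shape.
rewrite (fubini_tonelli (m1 := mu) (m2 := P) K)//.
apply: ge0_ae_eq_integral => //.
- exact: (measurable_fun_fubini_tonelli_G (m1 := mu) K).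
- by apply: measurable_excess_mass => s; exact: measurable_Z.
- by move=> w _; exact: integral_ge0.
- by move=> w _; exact: excess_mass_ge0.
have nMS : {ae P, forall w, ~ (0 < sup_exp Z w /\ int_exp Z mu w = 0)}.
  exists [set w | 0 < sup_exp Z w /\ int_exp Z mu w = 0]; split => //.
  - rewrite (_ : [set w | _] = (setT `&` [set w | 0 < sup_exp Z w]) `&`
        (int_exp Z mu @^-1` [set 0])).
      apply: measurableI; first exact: emeasurable_fun_o_infty.
      by rewrite -[X in measurable X]setTI; exact: S_meas.
    by apply/seteqP; split => w /= [h1 h2]; [split => //; split|split; case: h1].
  - by move=> w /= /contrapT.
apply: filterS2 S_fin nMS => w Sy nMS _.
exact: integral_shape_excess_mass.
Qed.

End intensities.

(** * Distribution functions of the two max-stable processes *)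

Section max_process.
Context {R : realType} (dT : measure_display) (T : measurableType dT).
Context (dV : measure_display) (V : measurableType dV).
Context (X : nat -> V -> R) (Y : nat -> T -> V -> \bar R).

Lemma max_process_le (n : nat) (t : 'I_n -> T) (x : 'I_n -> \bar R) :
  [set v | forall j, max_process X Y (t j) v <= x j] =
  [set v | forall i, below_levels t x (X i v) (path_of (Y i) v)].
Proof.
apply/seteqP; split => v /= h.
  by move=> i j; apply: le_trans (h j); apply: ereal_sup_ubound; exists i.
by move=> j; apply: ge_ereal_sup => _ [i _ <-]; exact: h.
Qed.

Lemma measurable_max_process s :
  (forall i, measurable_fun setT (X i)) ->
  (forall i s, measurable_fun setT (Y i s)) ->
  measurable_fun setT (max_process X Y s).
Proof.
move=> mX mY.
have mXY i : measurable_fun setT (fun v => (X i v)%:E + Y i s v).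
  by apply: emeasurable_funD => //; exact/measurable_EFinP.
apply: (eq_measurable_fun (fun v => esups (fun i => (X i v)%:E + Y i s v) 0%N)).
  move=> v _; rewrite /esups /max_process; congr ereal_sup.
  by apply/seteqP; split => _ [i _ <-]; exists i.
exact: measurable_fun_esups.
Qed.

End max_process.

Section laws.
Context {R : realType} (dT : measure_display) (T : measurableType dT).
Context (dW : measure_display) (W : measurableType dW) (P : probability W R).
Variable Z : {mfun (T * W)%type >-> \bar R}.
Variable mu : {sigma_finite_measure set T -> \bar R}.
Context (dV : measure_display) (V : measurableType dV) (Q : probability V R).
Context (n : nat) (t : 'I_n -> T) (x : 'I_n -> \bar R).
Local Notation leb := (@lebesgue_measure R).
Local Notation Zp := (fun s w => Z (s, w)).

(** Marks independent of the points form the special case of a constant kernel: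
the integrand on the right is constant. *)
Lemma spectral_marks (X : nat -> V -> R) (Zs : nat -> T -> V -> \bar R)
    (m : nat) (A : 'I_m -> set (T -> \bar R)) (G : set V) :
  spectral_representation P Z Q X Zs ->
  (forall i, path_sigma (A i)) -> sigma_of X G ->
  Q (G `&` \bigcap_(i in [set: 'I_m]) (path_of (Zs i) @^-1` A i)) =
  \int[Q]_(v in G) \prod_(i < m) P (path_of Zp @^-1` A i).
Proof.
move=> [ppX mZs lawZs indep] sA sG.
have mG : measurable G by apply: sigma_of_measurable sG; case: ppX.
pose A' k := \bigcap_(i in [set i : 'I_m | nat_of_ord i = k]) A i.
have A'E i : A' (nat_of_ord i) = A i.
  apply/seteqP; split => f /= h; first exact: h.
  by move=> j /= /val_inj ->.
pose B (o : option nat) :=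
  if o is Some k then path_of (Zs k) @^-1` A' k else G.
pose s := None :: [seq Some (nat_of_ord i) | i <- index_enum 'I_m].
have us : uniq s.
  rewrite /= map_inj_uniq ?index_enum_uniq ?andbT; last by move=> i j [/val_inj].
  by apply/negP => /mapP[].
have FB o : o \in s -> (if o is Some i then sigma_of (Zs i) else sigma_of X) (B o).
  rewrite inE => /predU1P[->//|/mapP[i _ ->]] /=.
  by rewrite A'E; exact: sigma_of_path.
rewrite integral_cst// muleC.
transitivity (Q (\bigcap_(o in [set` s]) B o)).
  congr (Q _); apply/seteqP; split => v.
    move=> [Gv Av] o /=; rewrite inE => /predU1P[->//|/mapP[i _ ->]] /=.
    by rewrite A'E; exact: Av.
  move=> h; split; first by apply: (h None); rewrite /= inE eqxx.
  move=> i _; have := h (Some (nat_of_ord i)); rewrite /= A'E; apply.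
  by rewrite inE; apply/orP; right; apply/mapP; exists i; rewrite ?mem_index_enum.
rewrite (indep s B us FB) big_cons big_map; congr (_ * _).
by apply: eq_bigr => i _; rewrite /= A'E lawZs.
Qed.

Lemma spectral_cdf (X : nat -> V -> R) (Zs : nat -> T -> V -> \bar R) :
  spectral_representation P Z Q X Zs ->
  Q [set v | forall j, max_process X Zs (t j) v <= x j] =
  expeR (- \int[P]_w excess_mass t x (path_of Zp w)).
Proof.
move=> rep; have [ppX mZs _ _] := rep.
have mZ s : measurable_fun setT (Zp s) by exact: measurable_Z.
have mpath A : path_sigma A -> measurable (path_of Zp @^-1` A).
  exact: measurable_path.
rewrite max_process_le -spectral_exponent.
have mexp : measurable_fun setT (fun p : R => expR (- p)%R).
  exact: measurableT_comp.
apply: (@marked_poisson_void R _ V Q _ (measurableTypeR R) leb (fun p => expR (- p)) _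
  (@path_sigma R T) X (fun i v => path_of (Zs i) v)
  (fun _ A => P (path_of Zp @^-1` A)) (below_levels t x) id) => //.
- by move=> i A sA; exact: measurable_path.
- by move=> _ A sA; rewrite measure_ge0 probability_le1//; exact: mpath.
- by move=> m A G sA sG; exact: (spectral_marks rep sA sG).
- exact: path_sigma_below_levels.
- exact: near_below_levels.
- move=> q p _ qp cq.
  have mb r : measurable (path_of Zp @^-1` below_levels t x r).
    by apply: mpath; exact: path_sigma_below_levels.
  have PE B : measurable B -> P B = \int[P]_(w in B) cst 1 w.
    by move=> mB; rewrite integral_cst// mul1e.
  rewrite PE//; under eq_fun do rewrite PE//.
  apply: cvg_integral_near_set => //.
  + by rewrite -PE// probability_setT ltry.
  + by move=> w; exact: near_below_levels.
Qed.

Hypothesis Z_lty : forall t w, Z (t, w) < +oo.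
Hypothesis EexpZ : forall t, \int[P]_w expeR (Z (t, w)) = 1.
Hypothesis M_meas : measurable_fun setT (sup_exp Z).
Hypothesis S_meas : measurable_fun setT (int_exp Z mu).
Hypothesis S_fin : {ae P, forall w, int_exp Z mu w < +oo}.
Hypothesis MS0 : P [set w | 0 < sup_exp Z w /\ int_exp Z mu w = 0] = 0.

Lemma shape_cdf (X : nat -> V -> R) (S : nat -> V -> T)
    (Fs : nat -> T -> V -> \bar R) :
  shape_representation P Z mu Q X S Fs ->
  Q [set v | forall j, max_process X Fs (t j) v <= x j] =
  expeR (- \int[P]_w excess_mass t x (path_of Zp w)).
Proof.
move=> [ppXS mFs marksE].
rewrite max_process_le -(shape_exponent t x Z_lty EexpZ S_meas S_fin MS0 M_meas).
apply: (@marked_poisson_void R _ V Q _ (measurableTypeR R * T)%type (leb \x mu)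
  (fun e => expR (- e.1)) _ (@path_sigma R T) (fun i v => (X i v, S i v))
  (fun i v => path_of (Fs i) v) (fun e A => shape_law P Z mu e.2 A)
  (below_levels t x) fst) => //.
- by apply: measurableT_comp => //; exact: measurableT_comp.
- by move=> i A sA; exact: measurable_path.
- by move=> e A sA; exact: shape_law_ge0_le1.
- move=> A sA; apply: (measurableT_comp (f := fun h => shape_law P Z mu h A)) => //.
  exact: measurable_shape_law.
- exact: path_sigma_below_levels.
- exact: near_below_levels.
- move=> q p e qp cq; have sb r := path_sigma_below_levels t x r.
  rewrite shape_lawE//; under eq_fun do rewrite shape_lawE//.
  apply: cvg_integral_near_set.
  + exact: measurable_expZ.
  + by move=> w; exact: expeR_ge0.
  + by rewrite EexpZ ltry.
  + by move=> m; apply: measurable_path => // s; exact: measurable_shape.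
  + by apply: measurable_path => // s; exact: measurable_shape.
  + by move=> w; exact: near_below_levels.
Qed.

End laws.

Theorem theorem6p4 (R : realType) (k : index_kind) (d : nat) (hd : (1 <= d)%N)
    (mu : {sigma_finite_measure set (index_space R k d) -> \bar R})
    (dW : measure_display) (W : measurableType dW) (P : probability W R)
    (Z : {mfun (index_space R k d * W)%type >-> \bar R})
    (Z_lty : forall t w, Z (t, w) < +oo)
    (EexpZ : forall t, \int[P]_w expeR (Z (t, w)) = 1)
    (M_meas : measurable_fun setT (sup_exp Z))
    (M_fin : {ae P, forall w, sup_exp Z w < +oo})
    (S_meas : measurable_fun setT (int_exp Z mu))
    (S_fin : {ae P, forall w, int_exp Z mu w < +oo})
    (MS0 : P [set w | 0 < sup_exp Z w /\ int_exp Z mu w = 0] = 0)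
    (d1 : measure_display) (W1 : measurableType d1) (P1 : probability W1 R)
    (X1 : nat -> W1 -> R) (Zs : nat -> index_space R k d -> W1 -> \bar R)
    (hzeta : spectral_representation P Z P1 X1 Zs)
    (d2 : measure_display) (W2 : measurableType d2) (P2 : probability W2 R)
    (X2 : nat -> W2 -> R) (T2 : nat -> W2 -> index_space R k d)
    (Fs : nat -> index_space R k d -> W2 -> \bar R)
    (hshape : shape_representation P Z mu P2 X2 T2 Fs) :
  fdd_eq P1 (max_process X1 Zs) P2 (max_process X2 Fs).
Proof.
have [[mX1 _ _ _] mZs _ _] := hzeta.
have [[mXT2 _ _ _] mFs _] := hshape.
have mX2 i : measurable_fun setT (X2 i).
  exact: (measurableT_comp measurable_fst (mXT2 i)).
apply: cdf_fdd_eq => [t|t|n t x].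
- exact: measurable_max_process.
- exact: measurable_max_process.
- rewrite (spectral_cdf t x hzeta).
  by rewrite (shape_cdf t x Z_lty EexpZ M_meas S_meas S_fin MS0 hshape).
Qed.
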